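(* Let $A\subseteq\mathbb B(H)$ be a commutative von Neumann algebra, let $M=(m_{jk})_{j,k\in\mathbb N}$ be an infinite matrix with entries in $A$, and put $p_{jk}=(m_{jk}^*m_{jk})^{1/2}$. Suppose there are positive constants $B_c,B_r$ such that, for all $k\in\mathbb N$, the series $\sum_{j=1}^{\infty}p_{jk}$ converges in norm in $A$ with $\left\|\sum_{j=1}^{\infty}p_{jk}\right\|\le B_c$, and, for all $j\in\mathbb N$, the series $\sum_{k=1}^{\infty}p_{jk}$ converges in norm in $A$ with $\left\|\sum_{k=1}^{\infty}p_{jk}\right\|\le B_r$. Then the formula $$(L_M((a_k)_k))_j=\sum_{k=1}^{\infty}m_{jk}a_k,\qquad j\in\mathbb N,\ (a_k)_k\in\ell^2(A),$$ defines a bounded module map $L_M:\ell^2(A)\to\ell^2(A)$ that extends to an adjointable map $L_M:\ell^2_{\mathrm{strong}}(A)\to\ell^2_{\mathrm{strong}}(A)$ such that $\|L_M\|\le(B_rB_c)^{1/2}$.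
   Context: $\ell^2(A)=\{(a_n)_{n\in\mathbb N}: a_n\in A,\ \sum_n a_na_n^*\text{ converges in norm}\}$ with $\langle (a_n),(b_n)\rangle=\sum_n a_nb_n^*$. $\ell^2_{\mathrm{strong}}(A)=\{(a_n)_{n\in\mathbb N}: a_n\in A,\ \sup_N\|\sum_{n=1}^Na_na_n^*\|<\infty\}$, a Hilbert $A$-module with inner product $\langle (a_n),(b_n)\rangle=\text{(strong)}\sum_{n} a_nb_n^*$ (strong operator topology of $\mathbb B(H)$), containing $\ell^2(A)$. Both are left Hilbert $A$-modules; a module map is an $A$-linear map. *)

(* Defs.v *)
(* The field of complex numbers is R[i] for R : realType. *)
From HB Require Import structures.
From mathcomp Require Import all_boot all_order all_algebra.
From mathcomp Require Import complex.
From mathcomp Require Import all_classical all_reals all_analysis.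

Set Implicit Arguments.
Unset Strict Implicit.
Unset Printing Implicit Defensive.

Import Order.TTheory GRing.Theory Num.Theory.
Import numFieldNormedType.Exports.

Local Open Scope classical_set_scope.
Local Open Scope ring_scope.

(* A complex Hilbert space is a complete normed module H over R[i] together
   with an inner product, linear in its first argument (the convention of
   {dot H for _}), inducing the norm of H. *)
Definition hilbert_dot (R : realType) (H : completeNormedModType R[i])
    (dot : {dot H for (@Num.conj R[i])}) : Prop :=
  forall x : H, `|x| ^+ 2 = dot x x.

Definition bounded_op (R : realType) (H : completeNormedModType R[i]) :
    set (H -> H) :=
  [set T | linear T /\ continuous T].

(* The norm of H takes (real) values in R[i], hence the real part. The
   supremum is the operator norm only for T in bounded_op: the supremum of an
   unbounded set is 0. *)
Definition opnorm (R : realType) (H : completeNormedModType R[i])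
    (T : H -> H) : R :=
  sup [set complex.Re `|T x| | x in [set x : H | `|x| <= 1]].

Definition opseries_cvg (R : realType) (H : completeNormedModType R[i])
    (u : nat -> H -> H) (S : H -> H) : Prop :=
  opnorm (\sum_(n < N) u n - S) @[N --> \oo] --> (0 : R).

Definition is_adjoint (R : realType) (H : completeNormedModType R[i])
    (dot : {dot H for (@Num.conj R[i])}) (T S : H -> H) : Prop :=
  forall x y : H, dot (T x) y = dot x (S y).

(* Every T in bounded_op has a unique bounded adjoint; the default value 0 is
   never reached on bounded_op. *)
Definition adj (R : realType) (H : completeNormedModType R[i])
    (dot : {dot H for (@Num.conj R[i])}) (T : H -> H) : H -> H :=
  xget 0 [set S | bounded_op S /\ is_adjoint dot T S].

(* The order of R[i] makes 0 <= z imply that z is real. *)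
Definition positive_op (R : realType) (H : completeNormedModType R[i])
    (dot : {dot H for (@Num.conj R[i])}) (T : H -> H) : Prop :=
  bounded_op T /\ forall x : H, 0 <= dot (T x) x.

(* P = T^(1/2) *)
Definition is_sqrt_op (R : realType) (H : completeNormedModType R[i])
    (dot : {dot H for (@Num.conj R[i])}) (T P : H -> H) : Prop :=
  positive_op dot P /\ P \o P = T.

(* Unital *-subalgebras of B(H) closed in the strong operator topology, which
   is the topology induced on B(H) by pointwise convergence. *)
Record von_neumann_algebra (R : realType) (H : completeNormedModType R[i])
    (dot : {dot H for (@Num.conj R[i])}) (A : set (H -> H)) : Prop := {
  vna_bounded : A `<=` @bounded_op R H;
  vna_id : A idfun;
  vna_add : forall S T, A S -> A T -> A (S + T);
  vna_scale : forall (c : R[i]) T, A T -> A (c *: T);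
  vna_comp : forall S T, A S -> A T -> A (S \o T);
  vna_adj : forall T, A T -> exists2 S, A S & is_adjoint dot T S;
  vna_closed : forall T, bounded_op T ->
    closure (A : set {ptws H -> H}) T -> A T
}.

Definition commutative_alg (R : realType) (H : completeNormedModType R[i])
    (A : set (H -> H)) : Prop :=
  forall S T, A S -> A T -> S \o T = T \o S.

Definition l2 (R : realType) (H : completeNormedModType R[i])
    (dot : {dot H for (@Num.conj R[i])}) (A : set (H -> H)) :
    set (nat -> H -> H) :=
  [set a : nat -> H -> H | (forall n, A (a n)) /\
    exists2 S, A S & opseries_cvg (fun n => a n \o adj dot (a n)) S].

Definition l2_strong (R : realType) (H : completeNormedModType R[i])
    (dot : {dot H for (@Num.conj R[i])}) (A : set (H -> H)) :
    set (nat -> H -> H) :=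
  [set a : nat -> H -> H | (forall n, A (a n)) /\
    exists K : R, forall N,
      opnorm (\sum_(n < N) (a n \o adj dot (a n))) <= K].

(* (strong) \sum_n a_n b_n^*, which on l2 agrees with the norm-convergent
   sum. *)
Definition l2_dot (R : realType) (H : completeNormedModType R[i])
    (dot : {dot H for (@Num.conj R[i])}) (a b : nat -> H -> H) : H -> H :=
  fun x => lim ((\sum_(n < N) a n (adj dot (b n) x)) @[N --> \oo]).

Definition l2_norm (R : realType) (H : completeNormedModType R[i])
    (dot : {dot H for (@Num.conj R[i])}) (a : nat -> H -> H) : R :=
  Num.sqrt (opnorm (l2_dot dot a a)).

(* A-linear maps from E to itself, E being a left A-module of sequences. *)
Definition module_map (R : realType) (H : completeNormedModType R[i])
    (A : set (H -> H)) (E : set (nat -> H -> H))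
    (L : (nat -> H -> H) -> (nat -> H -> H)) : Prop :=
  (forall a, E a -> E (L a)) /\
  forall (c : H -> H) a b, A c -> E a -> E b ->
    L (fun n => c \o a n + b n) = (fun n => c \o L a n + L b n).

(* Operator norm of a module map on E; +oo if it is not bounded. *)
Definition module_map_norm (R : realType) (H : completeNormedModType R[i])
    (dot : {dot H for (@Num.conj R[i])}) (E : set (nat -> H -> H))
    (L : (nat -> H -> H) -> (nat -> H -> H)) : \bar R :=
  ereal_sup [set (l2_norm dot (L a))%:E |
    a in [set a | E a /\ l2_norm dot a <= 1]].

Definition adjointable (R : realType) (H : completeNormedModType R[i])
    (dot : {dot H for (@Num.conj R[i])}) (E : set (nat -> H -> H))
    (L : (nat -> H -> H) -> (nat -> H -> H)) : Prop :=
  exists2 L' : (nat -> H -> H) -> (nat -> H -> H),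
    forall b, E b -> E (L' b) &
    forall a b, E a -> E b -> l2_dot dot (L a) b = l2_dot dot a (L' b).

(* Main.v *)
Require Import Defs.
From HB Require Import structures.
From mathcomp Require Import all_boot all_order all_algebra.
From mathcomp Require Import complex.
From mathcomp Require Import all_classical all_reals all_analysis.
From mathcomp Require Import ring lra.

(* With p_jk = |m_jk| the proof rests on the Schwarz-type inequality
     2 |<m v, w>| <= t <p v, v> + t^-1 <p w, w>     (m normal, p = |m|, t > 0).
   Summed over a row (taking for w the sum itself and for t the bound of the
   row) it gives
     |sum_k m_jk v_k|^2 <= B_r sum_k <p_jk v_k, v_k>,
   and summing over j bounds the right-hand side by B_r B_c sum_k |v_k|^2.
   Since A is commutative, |a_n^* x| = |a_n x|, so membership of (a_n) in the
   strong l2-space means that sum_n |a_n x|^2 <= K |x|^2 for all x, and the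
   estimates apply to the vectors v_k = a_k x. The norm convergence of the
   series of the p_jk gives uniform control of the tails: along rows it makes
   sum_k m_jk a_k converge in norm even for (a_k) in the strong space, along
   columns it makes the map preserve l2(A). The adjoint is given by the
   matrix of the adjoints of the m_kj. Only the real inner product Re <x, y> is used. *)

Set Implicit Arguments.
Unset Strict Implicit.
Unset Printing Implicit Defensive.

Import Order.TTheory GRing.Theory Num.Theory.
Import numFieldNormedType.Exports.

Local Open Scope classical_set_scope.
Local Open Scope ring_scope.

(** * The real inner product *)

Lemma gt0_complex (R : realType) (e : R[i]) : 0 < e ->
  e = (complex.Re e)%:C%C /\ 0 < complex.Re e.
Proof. by case: e => a b; rewrite ltcE /= => /andP[/eqP -> ->]. Qed.

Section RealInnerProduct.
Variables (R : realType) (H : completeNormedModType R[i]).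
Variable dot : {dot H for (@Num.conj R[i])}.

Definition rdot (x y : H) : R := complex.Re (dot x y).
Definition nrm (x : H) : R := complex.Re `|x|.

Lemma normE x : `|x| = (nrm x)%:C%C.
Proof.
rewrite /nrm; have := normr_ge0 x; case: `|x| => a b.
by rewrite lecE /= => /andP[/eqP ->].
Qed.

Lemma nrm_ge0 x : 0 <= nrm x.
Proof. by have := normr_ge0 x; rewrite normE lecR. Qed.

Lemma rdotDl x y z : rdot (x + y) z = rdot x z + rdot y z.
Proof. by rewrite /rdot linearDl raddfD. Qed.

Lemma rdotZl (t : R) x y : rdot (t%:C%C *: x) y = t * rdot x y.
Proof.
rewrite /rdot linearZl_LR /=; case: (dot x y) => a b /=.
by rewrite mul0r subr0.
Qed.

Lemma rdotC x y : rdot x y = rdot y x.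
Proof.
rewrite /rdot hermC expr0 mul1r.
have conjE (z : R[i]) : complex.Re (Num.conj z) = complex.Re z by case: z.
exact: conjE.
Qed.

Lemma rdot_ge0 x : 0 <= rdot x x.
Proof. by have := dnorm_ge0 dot x; rewrite lecE => /andP[]. Qed.

Lemma rdot_eq0 x : rdot x x = 0 -> x = 0.
Proof.
move=> h; apply/eqP; rewrite -(dnorm_eq0 dot).
have := dnorm_ge0 dot x; rewrite lecE => /andP[/eqP h1 _].
by rewrite eq_complex -/(rdot x x) h h1 /= eqxx.
Qed.

Lemma rdotNl x y : rdot (- x) y = - rdot x y.
Proof. by rewrite /rdot linearNl raddfN. Qed.

Lemma rdotBl x y z : rdot (x - y) z = rdot x z - rdot y z.
Proof. by rewrite rdotDl rdotNl. Qed.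

Lemma rdotBr x y z : rdot z (x - y) = rdot z x - rdot z y.
Proof. by rewrite rdotC rdotBl !(rdotC z). Qed.

Lemma rdotZr (t : R) x y : rdot y (t%:C%C *: x) = t * rdot y x.
Proof. by rewrite rdotC rdotZl (rdotC x). Qed.

Lemma rdot0l x : rdot 0 x = 0.
Proof. by rewrite -(subrr 0) rdotBl subrr. Qed.

Lemma rdot0r x : rdot x 0 = 0.
Proof. by rewrite rdotC rdot0l. Qed.

Lemma rdot_suml (I : Type) (s : seq I) (P : pred I) (F : I -> H) y :
  rdot (\sum_(i <- s | P i) F i) y = \sum_(i <- s | P i) rdot (F i) y.
Proof. by apply: (big_morph (rdot^~ y)) => [a b|]; [exact: rdotDl|exact: rdot0l]. Qed.

Lemma rdot_sumr (I : Type) (s : seq I) (P : pred I) (F : I -> H) y :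
  rdot y (\sum_(i <- s | P i) F i) = \sum_(i <- s | P i) rdot y (F i).
Proof. by rewrite rdotC rdot_suml; apply: eq_bigr => i _; exact: rdotC. Qed.

Lemma rdot_inj x x' : (forall y, rdot x y = rdot x' y) -> x = x'.
Proof.
move=> h; apply/eqP; rewrite -subr_eq0; apply/eqP/rdot_eq0.
by rewrite rdotBl h subrr.
Qed.

(** Expand the square of [s x - y] and divide by [s]. *)
Lemma rdot_young x y (s : R) : 0 < s -> 2 * rdot x y <= s * rdot x x + s^-1 * rdot y y.
Proof.
move=> s0; have := rdot_ge0 (s%:C%C *: x - y).
rewrite !(rdotBl, rdotBr, rdotZl, rdotZr) (rdotC y x) => h.
rewrite -(ler_pM2l s0) [leRHS]mulrDr (mulrA s s^-1) divff ?gt_eqF// mul1r; nra.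
Qed.

Hypothesis hdot : hilbert_dot dot.

Lemma rdotE x : rdot x x = nrm x ^+ 2.
Proof. by rewrite /rdot -hdot normE -rmorphXn. Qed.

Lemma nrm_le_sq x (c : R) : 0 <= c -> rdot x x <= c ^+ 2 -> nrm x <= c.
Proof. by move=> c0; rewrite rdotE ler_sqr ?nnegrE ?nrm_ge0. Qed.

Lemma rdot_CS x y : `|rdot x y| <= nrm x * nrm y.
Proof.
have [/eqP y0|y0] := boolP (y == 0); first by rewrite y0 rdot0r normr0 mulr_ge0// nrm_ge0.
have [/eqP x0|x0] := boolP (x == 0); first by rewrite x0 rdot0l normr0 mulr_ge0// nrm_ge0.
have np z : z != 0 -> 0 < nrm z.
  by move=> z0; have := z0; rewrite -normr_gt0 normE ltcR.
have hx := np _ x0; have hy := np _ y0.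
(* This weight makes both terms of [rdot_young] equal to |x| |y|. The bound is then proved for every
   [u] of the norm of [x], so that it serves both x and -x. *)
have s0 : 0 < nrm y / nrm x by rewrite divr_gt0.
have h u : nrm u = nrm x -> rdot u y <= nrm x * nrm y.
  move=> e; have := rdot_young u y s0; rewrite !rdotE e invf_div.
  have -> : nrm y / nrm x * nrm x ^+ 2 + nrm x / nrm y * nrm y ^+ 2 = 2 * (nrm x * nrm y).
    by field; rewrite !gt_eqF.
  by rewrite ler_pM2l.
rewrite ler_norml h// andbT lerNl -rdotNl h//.
by rewrite /nrm normrN.
Qed.

Lemma cvg_nrmP (u : nat -> H) (l : H) :
  u n @[n --> \oo] --> l <-> nrm (l - u n) @[n --> \oo] --> (0 : R).
Proof.
split=> [|] h.
  apply/cvgrPdist_lt => e e0.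
  have /cvgrPdist_lt/(_ e%:C%C) := h; rewrite ltcR => /(_ e0).
  apply: filterS => n; rewrite normE ltcR sub0r normrN ger0_norm//; exact: nrm_ge0.
apply/cvgrPdist_lt => e e0.
have [e1 e2] := gt0_complex e0.
have /cvgrPdist_lt/(_ _ e2) := h.
apply: filterS => n; rewrite normE e1 ltcR sub0r normrN ger0_norm//; exact: nrm_ge0.
Qed.

Lemma cvg_rdotl (u : nat -> H) (l y : H) :
  u n @[n --> \oo] --> l -> rdot (u n) y @[n --> \oo] --> rdot l y.
Proof.
move=> /cvg_nrmP h; apply/cvgrPdist_le => e e0.
have n1 : 0 < nrm y + 1 by rewrite ltr_wpDl// nrm_ge0.
have /cvgrPdist_le/(_ (e / (nrm y + 1))) := h; rewrite divr_gt0// => /(_ isT).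
apply: filterS => n; rewrite sub0r normrN ger0_norm ?nrm_ge0// => hn.
rewrite -rdotBl (le_trans (rdot_CS _ _))//.
rewrite (le_trans (ler_wpM2r (nrm_ge0 _) hn))//.
by rewrite -mulrA ler_piMr ?(ltW e0)// mulrC ler_pdivrMr// mul1r lerDl.
Qed.

Lemma cvg_rdotr (u : nat -> H) (l y : H) :
  u n @[n --> \oo] --> l -> rdot y (u n) @[n --> \oo] --> rdot y l.
Proof. by move=> /(cvg_rdotl (y := y)); rewrite rdotC; under eq_cvg do rewrite rdotC. Qed.

Lemma cvg_rdot_sq (u : nat -> H) (l : H) :
  u n @[n --> \oo] --> l -> rdot (u n) (u n) @[n --> \oo] --> rdot l l.
Proof.
move=> h; have /cvg_nrmP hn := h.
(* The identity |u|^2 = 2 <u, l> - |l|^2 + |l - u|^2 reduces the claim to limits already known. *)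
have -> : (fun n => rdot (u n) (u n)) =
  (fun n => 2 * rdot (u n) l - rdot l l + nrm (l - u n) ^+ 2).
  apply/funext => n; rewrite -rdotE !(rdotBl, rdotBr) (rdotC l (u n)); ring.
rewrite [X in _ --> X](_ : rdot l l = 2 * rdot l l - rdot l l + 0 ^+ 2); last first.
  by rewrite expr0n /=; ring.
apply: cvgD; last exact: (cvgM hn hn).
apply: cvgB; last exact: cvg_cst.
by apply: cvgMr; exact: cvg_rdotl.
Qed.

Lemma cvg_of_rdot_cauchy (u : nat -> H) :
  (forall e : R, 0 < e -> exists N, forall n1 n2, (N <= n1 <= n2)%N ->
     rdot (u n2 - u n1) (u n2 - u n1) <= e) ->
  cvg (u n @[n --> \oo]).
Proof.
move=> h; apply/cauchy_cvgP/cauchyP => e e0.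
have [e1 e2] := gt0_complex e0.
(* The hypothesis bounds squared norms, whence the square; the factor 1/2 leaves room for the strict
   inequality of the ball. *)
have [N hN] := h ((complex.Re e / 2) ^+ 2) (exprn_gt0 _ (divr_gt0 e2 (ltr0Sn _ 1))).
exists (u N); exists N => // n /= Nn.
rewrite -ball_normE /= distrC normE e1 ltcR.
have := hN N n; rewrite leqnn Nn => /(_ isT) /nrm_le_sq.
move=> /(_ (ltW (divr_gt0 e2 (ltr0Sn _ 1))))/le_lt_trans; apply.
by rewrite gtr_pMr// invf_lt1// ltr1n.
Qed.

End RealInnerProduct.

(** * Comparison of symmetric forms *)

Section SymmetricForms.
Variables (R : realType) (V : lmodType R[i]) (r : V -> V -> R).
Hypothesis rDl : forall x y z, r (x + y) z = r x z + r y z.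
Hypothesis rZl : forall (t : R) x y, r (t%:C%C *: x) y = t * r x y.
Hypothesis rC : forall x y, r x y = r y x.
Hypothesis r_ge0 : forall x, 0 <= r x x.

Let rDr x y z : r z (x + y) = r z x + r z y.
Proof. by rewrite rC rDl !(rC z). Qed.
Let rZr (t : R) x y : r y (t%:C%C *: x) = t * r y x.
Proof. by rewrite rC rZl (rC x). Qed.
Let rE := (rDl, rDr, rZl, rZr).

Definition rlinear (T : V -> V) :=
  forall (t : R) x y, T (t%:C%C *: x + y) = t%:C%C *: T x + T y.

Lemma rlinear0 T : rlinear T -> T 0 = 0.
Proof. by move=> /(_ (- 1) 0 0); rewrite scaler0 add0r rmorphN rmorph1 scaleN1r addNr. Qed.

Lemma rlinearZ T (t : R) x : rlinear T -> T (t%:C%C *: x) = t%:C%C *: T x.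
Proof. by move=> hT; rewrite -[_ *: x]addr0 hT rlinear0// addr0. Qed.

(** Evaluate the nonnegative form of [T] at x - C^-1 T x and bound <T (T x), T x> by C |T x|^2; no
    square root of [T] has to be constructed. *)
Lemma pos_form_sq_le (T : V -> V) (C : R) : rlinear T ->
  (forall x y, r (T x) y = r x (T y)) -> (forall x, 0 <= r (T x) x) ->
  0 < C -> (forall x, r (T x) x <= C * r x x) ->
  forall x, r (T x) (T x) <= C * r (T x) x.
Proof.
move=> hT sT T0 C0 TC x.
have := T0 ((- C^-1)%:C%C *: T x + x).
rewrite hT !rE (sT (T x) x) -(ler_pM2l C0) mulr0.
set a := r (T x) (T x); set b := r (T (T x)) (T x); set c := r (T x) x.
rewrite (_ : C * (_ + _) = C^-1 * b - 2 * a + C * c); last by field; rewrite gt_eqF.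
have : C^-1 * b <= a by rewrite mulrC ler_pdivrMr// mulrC TC.
lra.
Qed.

(* If the infimum -l of the numerical range of P - X were negative, it would
   be an approximate eigenvalue, with X e ~ (P + l) e for some unit vector e;
   this is incompatible with |X e| = |P e|. *)
Lemma form_le_abs (X P : V -> V) (M : R) : rlinear X -> rlinear P ->
  (forall x y, r (X x) y = r x (X y)) -> (forall x y, r (P x) y = r x (P y)) ->
  (forall x, 0 <= r (P x) x) -> (forall x, r (X x) (X x) = r (P x) (P x)) ->
  (forall x, r (P x) (P x) <= M * r x x) ->
  forall x, r (X x) x <= r (P x) x.
Proof.
move=> lX lP sX sP P0 XP PM.
have N1 (v : V) : (-1)%:C%C *: v = - v by rewrite rmorphN rmorph1 scaleN1r.
have sqD a b : r (a + b) (a + b) = r a a + 2 * r a b + r b b.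
  by rewrite !rE (rC b a); ring.
have young a b (s : R) : 0 < s -> - (s * r a a + s^-1 * r b b) <= 2 * r a b.
  move=> s0; have := r_ge0 (s%:C%C *: a + b).
  rewrite !rE (rC b a) => h.
  rewrite -(ler_pM2l s0) mulrN [in leLHS]mulrDr (mulrA s s^-1) divff ?gt_eqF// mul1r; nra.
(* With M >= 1 the same constant also bounds the forms: 2 |<X x, x>| <= |X x|^2 + |x|^2 <= (M + 1)
   |x|^2 <= 2 M |x|^2, and likewise for [P]. *)
wlog M1 : M PM / 1 <= M.
  move=> wl; apply: (wl (Num.max 1 M)); last by rewrite le_max lexx.
  by move=> x; apply: le_trans (PM x) _; rewrite ler_wpM2r// le_max lexx orbT.
have M0 : 0 < M by lra.
have Xu x : r (X x) x <= M * r x x.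
  have := r_ge0 ((-1)%:C%C *: X x + x); rewrite !rE (rC x (X x)) XP.
  have := PM x; have := r_ge0 x; nra.
have Xl x : - (M * r x x) <= r (X x) x.
  have := r_ge0 (X x + x); rewrite !rE (rC x (X x)) XP.
  have := PM x; have := r_ge0 x; nra.
have Pu x : r (P x) x <= M * r x x.
  have := r_ge0 ((-1)%:C%C *: P x + x); rewrite !rE (rC x (P x)).
  have := PM x; have := r_ge0 x; nra.
(* The admissible shifts l, those with X <= P + l as forms; the aim is that their infimum is 0. *)
pose L := [set l : R | 0 <= l /\ forall x, r (X x) x <= r (P x) x + l * r x x].
have LM : L M.
  by split; [lra|move=> x; apply: le_trans (Xu x) _; rewrite lerDr].
have Llb : has_lbound L by exists 0 => l [].
pose l := inf L.
have l0 : 0 <= l by apply: lb_le_inf; [exists M|move=> y []].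
have Ll x : r (X x) x <= r (P x) x + l * r x x.
  (* The form [r] may be degenerate; where it vanishes, the member [M] of [L] already gives the
     inequality. *)
  rewrite -lerBlDl; have [x0|x0] := eqVneq (r x x) 0.
    by have := LM.2 x; rewrite x0 !mulr0; lra.
  have xp : 0 < r x x by rewrite lt_def x0 r_ge0.
  rewrite -ler_pdivrMr//; apply: lb_le_inf; first by exists M.
  by move=> k [k0 hk]; rewrite ler_pdivrMr// lerBlDl.
have [le0|lp] := leP l 0.
  have l00 : l = 0 by apply/le_anti; rewrite le0.
  by move=> x; have := Ll x; rewrite l00 mul0r addr0.
exfalso.
pose B x := (P x + l%:C%C *: x) + (-1)%:C%C *: X x.
have lB : rlinear B.
  move=> t x y; rewrite /B lP lX !scalerDr !scalerA (mulrC l%:C%C) (mulrC (-1)%:C%C).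
  by rewrite (addrACA (_ *: P x)) (addrACA (_ *: P x + _)).
have sB x y : r (B x) y = r x (B y) by rewrite /B !rE sX sP.
have BE x : r (B x) x = r (P x) x + l * r x x - r (X x) x by rewrite /B !rE mulN1r.
have B0 x : 0 <= r (B x) x by rewrite BE subr_ge0.
pose C := 2 * M + l.
have C0 : 0 < C by rewrite /C; lra.
have BC x : r (B x) x <= C * r x x.
  by rewrite BE /C; have := Pu x; have := Xl x; lra.
have Bsq := pos_form_sq_le lB sB B0 C0 BC.
(* The Young weight for which s |P x|^2 <= s M |x|^2 = (l^2 / 2) |x|^2. *)
pose s := l ^+ 2 / (2 * M).
have s0 : 0 < s by rewrite /s divr_gt0 ?exprn_gt0// mulr_gt0.
pose D := (1 + s^-1) * C.
have D0 : 0 < D by rewrite /D mulr_gt0// addr_gt0// invr_gt0.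
(* Square P + l = X + B. The terms |P x|^2 = |X x|^2 cancel and <P x, x> >= 0, so l^2 |x|^2 <= 2 <X
   x, B x> + |B x|^2. Young with weight [s] and [Bsq] bound the right-hand side by (l^2 / 2) |x|^2 +
   D <B x, x>. *)
have gap x : l ^+ 2 / 2 * r x x <= D * r (B x) x.
  have e : r (P x + l%:C%C *: x) (P x + l%:C%C *: x) = r (X x + B x) (X x + B x).
    by congr (r _ _); rewrite /B N1 [RHS]addrC subrK.
  move: e; rewrite (sqD (P x)) (sqD (X x) (B x)) !rZr rZl XP => e.
  have := young (X x) (- B x) s s0.
  rewrite -(N1 (B x)) !rZl !rZr XP => y1.
  have sM : s * r (P x) (P x) <= l ^+ 2 / 2 * r x x.
    have -> : l ^+ 2 / 2 = s * M by rewrite /s; field; rewrite gt_eqF.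
    by rewrite -mulrA ler_pM2l.
  have si0 : 0 <= s^-1 by rewrite invr_ge0 ltW.
  have := ler_wpM2l si0 (Bsq x).
  have := mulr_ge0 l0 (P0 x); have := Bsq x; rewrite /D; nra.
(* By [gap], B is bounded below by this positive constant, so the shift can be lowered by it,
   against the choice of [l] as infimum. The minimum with [l] keeps l - d nonnegative. *)
pose d := Num.min l (l ^+ 2 / 2 / D).
have d0 : 0 < d by rewrite lt_min lp !divr_gt0// exprn_gt0.
suff : L (l - d) by move=> /(ge_inf Llb); rewrite -/l; lra.
split; first by rewrite subr_ge0 ge_min lexx.
move=> x; have : d * r x x <= r (B x) x.
  apply: (@le_trans _ _ (l ^+ 2 / 2 / D * r x x)); first by rewrite ler_wpM2r// ge_min lexx orbT.
  by rewrite mulrAC ler_pdivrMr// (mulrC _ D).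
rewrite BE; lra.
Qed.
End SymmetricForms.

(** * Bounded operators *)

Section Operators.
Variables (R : realType) (H : completeNormedModType R[i]).
Variable dot : {dot H for (@Num.conj R[i])}.
Hypothesis hdot : hilbert_dot dot.
Local Notation r := (rdot dot).

Lemma nrmZ (t : R) (x : H) : 0 <= t -> nrm (t%:C%C *: x) = t * nrm x.
Proof.
move=> t0; have := normrZ t%:C%C x.
rewrite (normE (_ *: x)) (normE x) ger0_norm ?lecR// -rmorphM => /complexI.
exact.
Qed.

Lemma nrmD (x y : H) : nrm (x + y) <= nrm x + nrm y.
Proof. by have := ler_normD x y; rewrite !normE -rmorphD lecR. Qed.

Lemma nrmN (x : H) : nrm (- x) = nrm x.
Proof. by rewrite /nrm normrN. Qed.

Lemma nrm_gt0 (x : H) : x != 0 -> 0 < nrm x.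
Proof. by rewrite -normr_gt0 normE ltcR. Qed.

Lemma bounded_op0 (T : H -> H) : bounded_op T -> T 0 = 0.
Proof. by move=> [lT _]; have := lT (-1) 0 0; rewrite scaler0 add0r scaleN1r addNr. Qed.

Lemma bounded_opD (T : H -> H) x y : bounded_op T -> T (x + y) = T x + T y.
Proof. by move=> [lT _]; rewrite -(scale1r x) lT !scale1r. Qed.

Lemma bounded_opN (T : H -> H) x : bounded_op T -> T (- x) = - T x.
Proof. by move=> hT; rewrite -(addr0 (- x)) -scaleN1r hT.1 scaleN1r (bounded_op0 hT) addr0. Qed.

Lemma bounded_op_sum (T : H -> H) (I : Type) (s : seq I) (P : pred I) (F : I -> H) :
  bounded_op T -> T (\sum_(i <- s | P i) F i) = \sum_(i <- s | P i) T (F i).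
Proof.
by move=> hT; apply: (big_morph T) => [a b|]; [exact: bounded_opD|exact: bounded_op0].
Qed.

Lemma bounded_op_rlinear (T : H -> H) : bounded_op T -> rlinear T.
Proof. by move=> [lT _] t x y; exact: lT. Qed.

Lemma bounded_op_bound (T : H -> H) : bounded_op T ->
  exists2 C : R, 0 < C & forall x, nrm (T x) <= C * nrm x.
Proof.
move=> hT; have [lT cT] := hT.
pose f : {linear H -> H} := HB.pack T (GRing.isLinear.Build _ _ _ _ T lT).
have [e e0 he] : exists2 e : R, 0 < e & forall x, nrm x < e -> nrm (T x) <= 1.
  have /cvgrPdist_le/(_ 1 ltr01) : T x @[x --> 0] --> T 0 by exact: (cT 0).
  move=> /nbhs_ballP[e /= e0 he].
  have [e1 e2] := gt0_complex e0.
  exists (complex.Re e); first exact: e2.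
  move=> x xe; have := he x; rewrite -ball_normE /= sub0r normrN normE e1 ltcR => /(_ xe).
  by rewrite (bounded_op0 hT) sub0r normrN normE lecR.
have e2 : 0 < 2 / e by rewrite divr_gt0.
exists (2 / e) => // x.
have [->|x0] := eqVneq x 0; first by rewrite bounded_op0// /nrm normr0 /= mulr0.
have nx := nrm_gt0 x0.
(* The vector is scaled to norm e / 2, strictly inside the ball on which |T x| <= 1. *)
have t0 : 0 < e / (2 * nrm x) by rewrite divr_gt0// mulr_gt0.
have := he ((e / (2 * nrm x))%:C%C *: x).
rewrite (rlinearZ _ _ (bounded_op_rlinear hT)) !(nrmZ _ (ltW t0)).
have -> : e / (2 * nrm x) * nrm x = e / 2 by field; rewrite gt_eqF.
have -> : e / 2 < e by rewrite gtr_pMr// invf_lt1// ltr1n.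
move=> /(_ isT); rewrite -ler_pdivlMl// => /le_trans; apply.
by rewrite mulr1 invf_div mulrAC.
Qed.

Lemma bounded_op_of_bound (T : H -> H) (C : R) : linear T ->
  (forall x, nrm (T x) <= C * nrm x) -> bounded_op T.
Proof.
move=> lT TC; split=> // x.
have TB a b : T (a - b) = T a - T b.
  by rewrite -scaleN1r addrC lT scaleN1r addrC.
apply/cvgrPdist_lt => e e0.
have [e1 e2] := gt0_complex e0.
have C1 : 0 < `|C| + 1 by rewrite ltr_wpDl.
have d0 : 0 < (complex.Re e / (`|C| + 1))%:C%C :> R[i] by rewrite ltcR divr_gt0.
apply/nbhs_ballP; exists (complex.Re e / (`|C| + 1))%:C%C => //= y.
rewrite -ball_normE /= normE ltcR ltr_pdivlMr// mulrC => h.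
rewrite -TB normE e1 ltcR; apply: le_lt_trans h.
apply: le_trans (TC _) _; rewrite ler_wpM2r ?nrm_ge0//.
by rewrite (le_trans (ler_norm C))// lerDl.
Qed.

Lemma opnorm_le (T : H -> H) (C : R) : 0 <= C ->
  (forall x, nrm (T x) <= C * nrm x) -> opnorm T <= C.
Proof.
move=> C0 TC; apply: ge_sup.
  by exists (nrm (T 0)); exists 0 => //=; rewrite normr0 ler01.
move=> _ [x /= x1 <-]; apply: le_trans (TC x) _.
by rewrite ler_piMr//; move: x1; rewrite normE lecR.
Qed.

Lemma opnorm_bound (T : H -> H) x : bounded_op T -> nrm (T x) <= opnorm T * nrm x.
Proof.
move=> hT; have [C C0 TC] := bounded_op_bound hT.
have [->|x0] := eqVneq x 0; first by rewrite bounded_op0// /nrm normr0 /= mulr0.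
have nx := nrm_gt0 x0.
rewrite -ler_pdivrMr//; apply: ub_le_sup.
  exists C => _ [y /= y1 <-]; apply: le_trans (TC y) _.
  by rewrite ler_piMr ?(ltW C0)//; move: y1; rewrite normE lecR.
have i0 : 0 <= (nrm x)^-1 by rewrite invr_ge0 nrm_ge0.
exists (((nrm x)^-1)%:C%C *: x).
  by rewrite /= normE nrmZ// mulVf ?gt_eqF.
by rewrite -/(nrm _) (rlinearZ _ _ (bounded_op_rlinear hT)) nrmZ// mulrC.
Qed.

Lemma opnorm_ge0 (T : H -> H) : bounded_op T -> 0 <= opnorm T.
Proof.
move=> hT; have [C C0 TC] := bounded_op_bound hT.
apply: (@le_trans _ _ (nrm (T 0))); first exact: nrm_ge0.
apply: ub_le_sup.
  exists C => _ [y /= y1 <-]; apply: le_trans (TC y) _.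
  by rewrite ler_piMr ?(ltW C0)//; move: y1; rewrite normE lecR.
by exists 0 => //=; rewrite normr0 ler01.
Qed.

Lemma rdot_op_bound (T : H -> H) x y : bounded_op T ->
  `|r (T x) y| <= opnorm T * (nrm x * nrm y).
Proof.
move=> hT; apply: le_trans (rdot_CS hdot _ _) _.
by rewrite mulrA ler_wpM2r ?nrm_ge0// opnorm_bound.
Qed.

Lemma rdot_op_le (T : H -> H) x : bounded_op T ->
  r (T x) x <= opnorm T * r x x.
Proof.
move=> hT; apply: le_trans (ler_norm _) _; apply: le_trans (rdot_op_bound _ _ hT) _.
by rewrite rdotE// expr2.
Qed.

(** Polarisation: <T z, z> is real for all z, so Im <T u, v> + Im <T v, u> = 0; replacing u by i x
    turns imaginary parts into real ones. *)
Lemma positive_op_sym (T : H -> H) : positive_op dot T ->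
  forall x y, r (T x) y = r x (T y).
Proof.
move=> [hT T0] x y.
have im z : complex.Im (dot (T z) z) = 0.
  by have := T0 z; rewrite lecE => /andP[/eqP].
have imS u v : complex.Im (dot (T u) v) + complex.Im (dot (T v) u) = 0.
  have := im (u + v); rewrite bounded_opD// linearDl !linearDr !raddfD /=.
  by rewrite !im add0r addr0.
have := imS ('i *: x) y.
rewrite -[_ *: x]addr0 hT.1 (bounded_op0 hT) !addr0 linearZl_LR linearZr_LR /=.
rewrite /rdot (hermC dot x (T y)) expr0 mul1r.
have conjE (z : R[i]) : complex.Re (Num.conj z) = complex.Re z by case: z.
rewrite conjE.
have iE (z : R[i]) : complex.Im ('i * z) = complex.Re z.
  by case: z => a b /=; rewrite mul0r mul1r add0r.
have iE' (z : R[i]) : complex.Im (Num.conj 'i * z) = - complex.Re z.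
  by case: z => a b /=; rewrite mul0r mulN1r add0r.
by rewrite iE iE' => /eqP; rewrite subr_eq0 => /eqP.
Qed.

Lemma positive_op_ge0 (T : H -> H) x : positive_op dot T -> 0 <= r (T x) x.
Proof. by move=> [_ /(_ x)]; rewrite lecE => /andP[]. Qed.

Lemma adjoint_rdot (T S : H -> H) x y : is_adjoint dot T S -> r (T x) y = r x (S y).
Proof. by rewrite /rdot => ->. Qed.

(** By [pos_form_sq_le], |T x|^2 <= C <T x, x> <= C^2 |x|^2. *)
Lemma opnorm_form_le (T : H -> H) (C : R) : 0 <= C -> rlinear T ->
  (forall x y, r (T x) y = r x (T y)) ->
  (forall x, 0 <= r (T x) x <= C * r x x) -> opnorm T <= C.
Proof.
(* The slack [e] supplies the positive constant that [pos_form_sq_le] requires, also when C = 0. *)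
move=> C0 lT sT TC; apply/ler_addgt0Pr => e e0.
have Ce : 0 < C + e by rewrite ltr_wpDl.
apply: opnorm_le; first exact: ltW.
move=> x; apply: (nrm_le_sq hdot); first by rewrite mulr_ge0 ?nrm_ge0// ltW.
have TC' y : r (T y) y <= (C + e) * r y y.
  have /andP[_ h] := TC y; apply: le_trans h _.
  by rewrite ler_wpM2r ?rdot_ge0// lerDl ltW.
apply: (@le_trans _ _ ((C + e) * r (T x) x)).
  apply: (pos_form_sq_le (rdotDl dot) (rdotZl dot) (rdotC dot)) => // y.
  by have /andP[] := TC y.
by rewrite exprMn -(rdotE hdot) expr2 -mulrA ler_pM2l.
Qed.

(** A dilation instead of a polar decomposition: on H x H the map X (v, w) = (m' w, m v) is
    symmetric although [m] need not be, it has the same norms as P = diag(p, p), and its form at (v,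
    w) is 2 <m v, w>. So [form_le_abs] applies. *)
Lemma rdot_le_abs (m m' p : H -> H) v w : bounded_op m -> bounded_op m' -> is_adjoint dot m m' ->
  positive_op dot p ->
  (forall x, r (m x) (m x) = r (p x) (p x)) -> (forall x, r (m' x) (m' x) = r (p x) (p x)) ->
  2 * r (m v) w <= r (p v) v + r (p w) w.
Proof.
move=> bm bm' ad pp mp m'p.
have bp := pp.1.
have [C C0 pC] := bounded_op_bound bp.
pose r2 (x y : H * H) := r x.1 y.1 + r x.2 y.2.
pose X (x : H * H) := (m' x.2, m x.1).
pose P (x : H * H) := (p x.1, p x.2).
suff : r2 (X (v, w)) (v, w) <= r2 (P (v, w)) (v, w).
  by rewrite /r2 /X /P /= rdotC -(adjoint_rdot _ _ ad); lra.
apply: (@form_le_abs R (H * H)%type r2 _ _ _ _ X P (C ^+ 2)); rewrite /r2 /X /P /=.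
- by move=> x y z; rewrite !rdotDl addrACA.
- by move=> t x y; rewrite !rdotZl mulrDr.
- by move=> x y; rewrite !(rdotC dot x.1) !(rdotC dot x.2).
- by move=> x; rewrite addr_ge0// rdot_ge0.
- by move=> t x y; congr pair; apply: bounded_op_rlinear.
- by move=> t x y; congr pair; apply: bounded_op_rlinear.
- move=> x y; rewrite (adjoint_rdot _ _ ad) addrC; congr (_ + _).
  by rewrite rdotC -(adjoint_rdot _ _ ad) rdotC.
- by move=> x y; rewrite !(positive_op_sym pp).
- by move=> x; rewrite addr_ge0// positive_op_ge0.
- by move=> x; rewrite mp m'p addrC.
- move=> x; rewrite mulrDr lerD//.
    by rewrite !rdotE// -exprMn ler_sqr ?nnegrE ?mulr_ge0 ?nrm_ge0// ltW.
  by rewrite !rdotE// -exprMn ler_sqr ?nnegrE ?mulr_ge0 ?nrm_ge0// ltW.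
Qed.

End Operators.

(** * Nonnegative series *)

Lemma sum_tail_small (R : realType) (V : nat -> R) (K : R) :
  (forall n, 0 <= V n) -> (forall N, \sum_(0 <= n < N) V n <= K) ->
  forall e, 0 < e -> exists N, forall N1 N2, (N <= N1)%N -> \sum_(N1 <= n < N2) V n <= e.
Proof.
move=> V0 VK e e0; pose E := range (fun N => \sum_(0 <= n < N) V n).
have hE : has_sup E.
  by split; [exists (\sum_(0 <= n < 0) V n), 0%N|exists K => _ [N _ <-]].
have [_ [N _ <-] hN] := sup_adherent e0 hE.
exists N => N1 N2 NN1.
have [N21|N12] := leqP N2 N1; first by rewrite big_geq// ltW.
have h : \sum_(0 <= n < N2) V n <= sup E by apply: sup_upper_bound => //; exists N2.
move: h; rewrite (@big_cat_nat _ _ _ N1)//= ?(ltnW N12)// (@big_cat_nat _ _ _ N)//=.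
have : 0 <= \sum_(N <= n < N1) V n by rewrite sumr_ge0.
lra.
Qed.

Lemma sum_sub_le (R : realType) (V : nat -> R) (K : R) :
  (forall n, 0 <= V n) -> (forall N, \sum_(0 <= n < N) V n <= K) ->
  forall N1 N2, \sum_(N1 <= n < N2) V n <= K.
Proof.
move=> V0 VK N1 N2; apply: le_trans (VK N2).
have [N21|/ltnW N12] := leqP N2 N1; first by rewrite big_geq// sumr_ge0.
by rewrite [leRHS](@big_cat_nat _ _ _ N1)//= lerDr sumr_ge0.
Qed.

(* Both iterated sums are compared with the square partial sums. *)
Lemma double_sum_swap (R : realType) (c : nat -> nat -> R) (f g U V : nat -> R) (KU KV : R) :
  (forall j, \sum_(0 <= k < M) c j k @[M --> \oo] --> f j) ->
  (forall k, \sum_(0 <= j < M) c j k @[M --> \oo] --> g k) ->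
  (forall n, 0 <= U n) -> (forall n, 0 <= V n) ->
  (forall N, \sum_(0 <= n < N) U n <= KU) -> (forall N, \sum_(0 <= n < N) V n <= KV) ->
  (forall J1 J2 K1 K2 t, 0 < t ->
    2 * `|\sum_(J1 <= j < J2) \sum_(K1 <= k < K2) c j k| <=
      t * \sum_(J1 <= j < J2) U j + t^-1 * \sum_(K1 <= k < K2) V k) ->
  \sum_(0 <= j < N) f j - \sum_(0 <= k < N) g k @[N --> \oo] --> (0 : R).
Proof.
have half (d : nat -> nat -> R) (h X Y : nat -> R) (KX KY : R) :
    (forall j, \sum_(0 <= k < M) d j k @[M --> \oo] --> h j) ->
    (forall n, 0 <= X n) -> (forall n, 0 <= Y n) ->
    (forall N, \sum_(0 <= n < N) X n <= KX) -> (forall N, \sum_(0 <= n < N) Y n <= KY) ->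
    (forall J1 J2 K1 K2 t, 0 < t ->
      2 * `|\sum_(J1 <= j < J2) \sum_(K1 <= k < K2) d j k| <=
        t * \sum_(J1 <= j < J2) X j + t^-1 * \sum_(K1 <= k < K2) Y k) ->
    \sum_(0 <= j < N) h j - \sum_(0 <= j < N) \sum_(0 <= k < N) d j k @[N --> \oo] --> (0 : R).
  move=> dh X0 Y0 XK YK db; apply/cvgrPdist_le => e e0.
  have KX0 : 0 <= KX by apply: le_trans (XK 0%N); rewrite big_geq.
  (* This weight keeps t times every partial sum of [X] below e; [N] is then taken so late that the
     tails of [Y] stay below t e. The two contributions add up to 2 e. *)
  pose t := e / (KX + 1).
  have t0 : 0 < t by rewrite divr_gt0// ltr_wpDl.
  have [N hN] := sum_tail_small Y0 YK (mulr_gt0 t0 e0).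
  exists N => // n /= Nn; rewrite sub0r normrN.
  have lim1 : \sum_(0 <= j < n) \sum_(0 <= k < M) d j k @[M --> \oo] --> \sum_(0 <= j < n) h j.
    by apply: cvg_big => [|j _]; [exact: add_continuous|exact: dh].
  have lim2 : `|\sum_(0 <= j < n) \sum_(0 <= k < M) d j k -
        \sum_(0 <= j < n) \sum_(0 <= k < n) d j k| @[M --> \oo] -->
      `|\sum_(0 <= j < n) h j - \sum_(0 <= j < n) \sum_(0 <= k < n) d j k|.
    by apply: cvg_norm; apply: cvgB => //; exact: cvg_cst.
  apply: (cvgr_to_le lim2).
  exists n => // M /= nM.
  rewrite -sumrB (eq_bigr (fun j => \sum_(n <= k < M) d j k)); last first.
    by move=> j _; rewrite (@big_cat_nat _ _ _ n 0%N M)//= addrAC subrr add0r.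
  rewrite -(@ler_pM2l _ 2)//; apply: le_trans (db _ _ _ _ _ t0) _.
  have h1 : t * \sum_(0 <= j < n) X j <= e.
    rewrite /t mulrAC ler_pdivrMr ?ltr_wpDl// ler_pM2l//.
    by apply: le_trans (XK _) _; rewrite lerDl.
  have h2 : t^-1 * \sum_(n <= k < M) Y k <= e.
    by rewrite ler_pdivrMl// hN.
  lra.
move=> cf cg U0 V0 UK VK cb.
have h1 := half c f U V KU KV cf U0 V0 UK VK cb.
have h2 := half (fun k j => c j k) g V U KV KU cg V0 U0 VK UK.
rewrite [X in _ --> X](_ : 0 = 0 - 0 :> R); last by rewrite subr0.
rewrite (_ : (fun N => _) = (fun N =>
  (\sum_(0 <= j < N) f j - \sum_(0 <= j < N) \sum_(0 <= k < N) c j k) -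
  (\sum_(0 <= k < N) g k - \sum_(0 <= k < N) \sum_(0 <= j < N) c j k))); last first.
  apply/funext => N; rewrite [in RHS](exchange_big_nat) /=; ring.
apply: cvgB => //; apply: h2 => J1 J2 K1 K2 t t0.
(* Transposing [c] exchanges the two weights, so the bound is used at t^-1. *)
rewrite exchange_big_nat /= addrC -[X in _ + X * _]invrK.
by apply: cb; rewrite invr_gt0.
Qed.

(** * The Schur test *)

Section SchurTest.
Variables (R : realType) (H : completeNormedModType R[i]).
Variable dot : {dot H for (@Num.conj R[i])}.
Hypothesis hdot : hilbert_dot dot.
Local Notation r := (rdot dot).

Definition sqsum_le (v : nat -> H) (K : R) :=
  forall N, \sum_(0 <= n < N) r (v n) (v n) <= K.

Lemma sqsum_le_ge0 v K : sqsum_le v K -> 0 <= K.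
Proof. by move=> /(_ 0%N); rewrite big_geq. Qed.

(** With the sum itself as test vector w and t = rho, the [q'] terms contribute at most |w|^2 and
    are absorbed by the left side 2 |w|^2. The forms [q'] are kept apart from [q] so that the lemma
    serves rows of a matrix as well as the sums of a_n u_n. *)
Lemma sum_sq_le (s : seq nat) (m : nat -> H -> H) (v : nat -> H) (q : nat -> R)
    (q' : nat -> H -> R) (rho : R) : 0 < rho ->
  (forall i w t, 0 < t -> 2 * r (m i (v i)) w <= t * q i + t^-1 * q' i w) ->
  (forall w, \sum_(i <- s) q' i w <= rho * r w w) ->
  r (\sum_(i <- s) m i (v i)) (\sum_(i <- s) m i (v i)) <= rho * \sum_(i <- s) q i.
Proof.
move=> rho0 mq q'rho; set w := \sum_(i <- s) m i (v i).
have h : 2 * r w w <= rho * \sum_(i <- s) q i + rho^-1 * \sum_(i <- s) q' i w.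
  by rewrite {1}/w rdot_suml !mulr_sumr -big_split /=; apply: ler_sum => i _; exact: mq.
have : rho^-1 * \sum_(i <- s) q' i w <= r w w by rewrite ler_pdivrMl.
lra.
Qed.

(* The forms q j k play the role of <|m j k| v, v>. *)
Record schur_matrix (m : nat -> nat -> H -> H) (q : nat -> nat -> H -> R) (Bc Br : R) : Prop := {
  sm_add : forall j k v w, m j k (v + w) = m j k v + m j k w;
  sm_form : forall j k v w t, 0 < t -> 2 * `|r (m j k v) w| <= t * q j k v + t^-1 * q j k w;
  sm_ge0 : forall j k v, 0 <= q j k v;
  sm_Br : 0 < Br;
  sm_Bc : 0 < Bc;
  sm_row : forall j K1 K2 w, \sum_(K1 <= k < K2) q j k w <= Br * r w w;
  sm_col : forall k J1 J2 w, \sum_(J1 <= j < J2) q j k w <= Bc * r w w;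
  sm_row_tail : forall j e, 0 < e -> exists N, forall K1 K2, (N <= K1)%N ->
    forall w, \sum_(K1 <= k < K2) q j k w <= e * r w w;
  sm_col_tail : forall k e, 0 < e -> exists N, forall J1 J2, (N <= J1)%N ->
    forall w, \sum_(J1 <= j < J2) q j k w <= e * r w w
}.

(** Passing to the adjoint entries exchanges v and w, hence t and t^-1, and rows and columns trade
    their conditions. *)
Lemma schur_matrix_tr (m m' : nat -> nat -> H -> H) q Bc Br : schur_matrix m q Bc Br ->
  (forall j k v w, m' j k (v + w) = m' j k v + m' j k w) ->
  (forall j k v w, r (m j k v) w = r v (m' k j w)) ->
  schur_matrix m' (fun j k => q k j) Br Bc.
Proof.
move=> S m'D mm'; split; try by case: S.
move=> j k v w t t0; rewrite rdotC -mm' addrC -[X in _ + X * _]invrK.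
by apply: (sm_form S); rewrite invr_gt0.
Qed.

Section Matrix.
Variables (m : nat -> nat -> H -> H) (q : nat -> nat -> H -> R) (Bc Br : R).
Hypothesis S : schur_matrix m q Bc Br.

Lemma schur_form_le j k w : q j k w <= Bc * r w w.
Proof. by have := sm_col S k j j.+1 w; rewrite big_nat1. Qed.

Lemma schur_row_sq (rho : R) j K1 K2 (v : nat -> H) : 0 < rho ->
  (forall w, \sum_(K1 <= k < K2) q j k w <= rho * r w w) ->
  r (\sum_(K1 <= k < K2) m j k (v k)) (\sum_(K1 <= k < K2) m j k (v k)) <=
    rho * \sum_(K1 <= k < K2) q j k (v k).
Proof.
move=> rho0 hrho.
apply: (@sum_sq_le _ (m j) v (fun k => q j k (v k)) (q j) rho rho0) => // k w t t0.
apply: le_trans (sm_form S j k (v k) w t0).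
by rewrite ler_pM2l// ler_norm.
Qed.

(** The small row tail is the constant in [schur_row_sq], and each q_jk costs a factor Bc, whence e
    / Bc. [N] does not depend on [v]; this uniformity later yields convergence in operator norm. *)
Lemma schur_row_tail j e : 0 < e -> exists N, forall K1 K2, (N <= K1)%N ->
  forall v K, sqsum_le v K ->
  r (\sum_(K1 <= k < K2) m j k (v k)) (\sum_(K1 <= k < K2) m j k (v k)) <= e * K.
Proof.
move=> e0; have eB : 0 < e / Bc by rewrite divr_gt0// (sm_Bc S).
have [N hN] := sm_row_tail S j eB.
exists N => K1 K2 NK v K vK; apply: le_trans (schur_row_sq v eB (hN K1 K2 NK)) _.
rewrite -mulrA ler_pM2l// ler_pdivrMl ?(sm_Bc S)//.
apply: (@le_trans _ _ (\sum_(K1 <= k < K2) Bc * r (v k) (v k))).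
  by apply: ler_sum => k _; exact: schur_form_le.
rewrite -mulr_sumr ler_pM2l ?(sm_Bc S)//.
by apply: sum_sub_le => // n; exact: rdot_ge0.
Qed.

(** The [lim] is a genuine limit for square-summable [v], by [mxapp_cvg]. *)
Definition mxapp (v : nat -> H) (j : nat) : H :=
  lim (\sum_(0 <= k < N) m j k (v k) @[N --> \oo]).

Lemma mxapp_cvg v K j : sqsum_le v K ->
  \sum_(0 <= k < N) m j k (v k) @[N --> \oo] --> mxapp v j.
Proof.
move=> vK; apply: (@cvg_of_rdot_cauchy _ _ _ hdot) => e e0.
have K0 := sqsum_le_ge0 vK.
have eK : 0 < e / (K + 1) by rewrite divr_gt0// ltr_wpDl.
have [N hN] := schur_row_tail j eK.
exists N => n1 n2 /andP[Nn1 n12].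
rewrite (@big_cat_nat _ _ _ n1)//= addrAC subrr add0r.
apply: le_trans (hN n1 n2 Nn1 v K vK) _.
by rewrite mulrAC ler_pdivrMr ?ltr_wpDl// ler_pM2l// lerDl.
Qed.

Lemma mxapp_trunc j e : 0 < e -> exists N, forall n, (N <= n)%N ->
  forall v K, sqsum_le v K ->
  r (\sum_(0 <= k < n) m j k (v k) - mxapp v j)
    (\sum_(0 <= k < n) m j k (v k) - mxapp v j) <= e * K.
Proof.
move=> e0; have [N hN] := schur_row_tail j e0.
exists N => n Nn v K vK.
have h : \sum_(0 <= k < n) m j k (v k) - \sum_(0 <= k < M) m j k (v k) @[M --> \oo] -->
    \sum_(0 <= k < n) m j k (v k) - mxapp v j.
  by apply: cvgB; [exact: cvg_cst|exact: (mxapp_cvg vK)].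
apply: (cvgr_to_le (cvg_rdot_sq hdot h)).
exists n => // M /= nM.
rewrite (@big_cat_nat _ _ _ n 0%N M)//= opprD addrA subrr add0r.
by rewrite rdotNl rdotC rdotNl opprK hN.
Qed.

(** Apply [schur_row_sq] to the truncated rows, exchange the finite sums, and pass to the limit. The
    bound [D] is left free: the whole column sums give boundedness, their tails give preservation of
    l2(A). *)
Lemma mxapp_sum_sq v K J1 J2 (D : R) : sqsum_le v K ->
  (forall N, \sum_(0 <= k < N) \sum_(J1 <= j < J2) q j k (v k) <= D) ->
  \sum_(J1 <= j < J2) r (mxapp v j) (mxapp v j) <= Br * D.
Proof.
move=> vK hD.
have h : \sum_(J1 <= j < J2) r (\sum_(0 <= k < N) m j k (v k)) (\sum_(0 <= k < N) m j k (v k))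
    @[N --> \oo] --> \sum_(J1 <= j < J2) r (mxapp v j) (mxapp v j).
  apply: cvg_big => [|j _]; first exact: add_continuous.
  by apply: cvg_rdot_sq => //; exact: (mxapp_cvg vK).
apply: (cvgr_to_le h); apply: nearW => N.
apply: (@le_trans _ _ (\sum_(J1 <= j < J2) Br * \sum_(0 <= k < N) q j k (v k))).
  apply: ler_sum => j _; apply: schur_row_sq; first exact: (sm_Br S).
  exact: (sm_row S j 0%N N).
by rewrite -mulr_sumr ler_pM2l ?(sm_Br S)// exchange_big_nat.
Qed.

Lemma mxapp_sqsum v K : sqsum_le v K -> sqsum_le (mxapp v) (Br * (Bc * K)).
Proof.
move=> vK N; apply: (mxapp_sum_sq vK) => M.
apply: (@le_trans _ _ (\sum_(0 <= k < M) Bc * r (v k) (v k))).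
  by apply: ler_sum => k _; exact: (sm_col S).
by rewrite -mulr_sumr ler_pM2l ?(sm_Bc S).
Qed.

(** The columns k < N0 are finitely many, so their tails are small beyond a common [J]; the columns
    k >= N0 meet only the part of [v] controlled by [D] and are bounded by [Bc]. [J] does not depend
    on [v]. *)
Lemma mxapp_tail (N0 : nat) e : 0 < e -> exists J, forall J1 J2, (J <= J1)%N ->
  forall v K D, sqsum_le v K -> (forall N, \sum_(N0 <= k < N) r (v k) (v k) <= D) ->
  \sum_(J1 <= j < J2) r (mxapp v j) (mxapp v j) <= Br * (e * K + Bc * D).
Proof.
move=> e0.
have [J hJ] : exists J, forall k J1 J2, (k < N0)%N -> (J <= J1)%N ->
    forall w, \sum_(J1 <= j < J2) q j k w <= e * r w w.
  elim: N0 => [|N0 [J hJ]]; first by exists 0%N.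
  have [J' hJ'] := sm_col_tail S N0 e0.
  exists (maxn J J') => k J1 J2; rewrite geq_max ltnS leq_eqVlt => /orP[/eqP->|kN] /andP[j1 j2] w.
    exact: hJ'.
  exact: hJ.
exists J => J1 J2 JJ v K D vK vD; apply: (mxapp_sum_sq vK) => N.
have D0 : 0 <= D by have := vD 0%N; rewrite big_geq.
have part1 M : (M <= N0)%N -> \sum_(0 <= k < M) \sum_(J1 <= j < J2) q j k (v k) <= e * K.
  move=> MN; apply: (@le_trans _ _ (\sum_(0 <= k < M) e * r (v k) (v k))).
    rewrite big_nat [leRHS]big_nat; apply: ler_sum => k /andP[_ kM].
    by apply: hJ => //; exact: leq_trans MN.
  by rewrite -mulr_sumr ler_pM2l.
have [NN|/ltnW NN] := leqP N N0.
  by apply: le_trans (part1 N NN) _; rewrite lerDl mulr_ge0// ltW// (sm_Bc S).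
rewrite (@big_cat_nat _ _ _ N0)//=; apply: lerD; first exact: part1.
apply: (@le_trans _ _ (\sum_(N0 <= k < N) Bc * r (v k) (v k))).
  by apply: ler_sum => k _; exact: (sm_col S).
by rewrite -mulr_sumr ler_pM2l ?(sm_Bc S).
Qed.

(** The domination that [double_sum_swap] asks for: the form inequality is summed termwise, using
    row sums at u_j and column sums at v_k. *)
Lemma schur_bilinear u v J1 J2 K1 K2 t : 0 < t ->
  2 * `|\sum_(J1 <= j < J2) \sum_(K1 <= k < K2) r (m j k (u j)) (v k)| <=
   t * \sum_(J1 <= j < J2) Br * r (u j) (u j) + t^-1 * \sum_(K1 <= k < K2) Bc * r (v k) (v k).
Proof.
move=> t0.
apply: (@le_trans _ _ (\sum_(J1 <= j < J2) \sum_(K1 <= k < K2)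
    (t * q j k (u j) + t^-1 * q j k (v k)))).
  rewrite -(ger0_norm (ler0n R 2)) -normrM mulr_sumr.
  apply: le_trans (ler_norm_sum _ _ _) _; apply: ler_sum => j _.
  rewrite mulr_sumr; apply: le_trans (ler_norm_sum _ _ _) _; apply: ler_sum => k _.
  by rewrite normrM ger0_norm//; exact: (sm_form S).
under eq_bigr do rewrite big_split /=.
rewrite big_split /=; apply: lerD.
  rewrite mulr_sumr; apply: ler_sum => j _; rewrite -mulr_sumr ler_pM2l//.
  exact: (sm_row S).
rewrite exchange_big_nat /= mulr_sumr; apply: ler_sum => k _.
by rewrite -mulr_sumr ler_pM2l ?invr_gt0//; exact: (sm_col S).
Qed.

End Matrix.
End SchurTest.

(** * Series of operators and von Neumann algebras *)

Section OperatorSeries.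
Variables (R : realType) (H : completeNormedModType R[i]).
Variable dot : {dot H for (@Num.conj R[i])}.
Hypothesis hdot : hilbert_dot dot.
Local Notation r := (rdot dot).

Lemma opnormN (T : H -> H) : opnorm (- T) = opnorm T.
Proof.
rewrite /opnorm; congr sup; apply/seteqP; split=> _ [x x1 <-]; exists x => //.
  by rewrite -normrN.
by rewrite [(- T) x]/(- (T x)) normrN.
Qed.

Lemma bounded_op_add (S T : H -> H) : bounded_op S -> bounded_op T -> bounded_op (S + T).
Proof.
move=> bS bT; have [CS _ hS] := bounded_op_bound bS; have [CT _ hT] := bounded_op_bound bT.
apply: (@bounded_op_of_bound _ _ _ (CS + CT)).
  move=> c x y; change (S (c *: x + y) + T (c *: x + y) = c *: (S x + T x) + (S y + T y)).
  by rewrite bS.1 bT.1 scalerDr addrACA.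
move=> x; rewrite [(S + T) x]/(S x + T x) mulrDl.
by apply: le_trans (nrmD _ _) _; apply: lerD.
Qed.

Lemma bounded_op_opp (T : H -> H) : bounded_op T -> bounded_op (- T).
Proof.
move=> bT; have [CT _ hT] := bounded_op_bound bT.
apply: (@bounded_op_of_bound _ _ _ CT).
  move=> c x y; change (- T (c *: x + y) = c *: (- T x) + - T y).
  by rewrite bT.1 opprD scalerN.
by move=> x; rewrite [(- T) x]/(- (T x)) nrmN.
Qed.

Lemma bounded_op_cst0 : bounded_op (0 : H -> H).
Proof.
apply: (@bounded_op_of_bound _ _ _ 0) => [c x y|x]; first by rewrite scaler0 addr0.
by rewrite mul0r /nrm normr0.
Qed.

Lemma bounded_op_bigsum (u : nat -> H -> H) N : (forall n, bounded_op (u n)) ->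
  bounded_op (\sum_(n < N) u n).
Proof.
move=> bu; elim/big_ind: _ => // [|S T]; first exact: bounded_op_cst0.
exact: bounded_op_add.
Qed.

Lemma opsumE (u : nat -> H -> H) N x : (\sum_(n < N) u n) x = \sum_(0 <= n < N) u n x.
Proof. by rewrite fct_sumE big_mkord. Qed.

(** All terms being nonnegative, a block is at most <S x, x> minus the first [N1] terms. Dropping
    these gives the norm of [S], keeping them gives the norm of the remainder: the first serves for
    bounds, the second for tails. *)
Lemma opseries_form_le (P : nat -> H -> H) (S : H -> H) : (forall n, bounded_op (P n)) ->
  (forall n x, 0 <= r (P n x) x) -> bounded_op S -> opseries_cvg P S ->
  forall N1 N2 x, \sum_(N1 <= n < N2) r (P n x) x <=
    Num.min (opnorm S) (opnorm (\sum_(n < N1) P n - S)) * r x x.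
Proof.
move=> bP P0 bS PS N1 N2 x.
have bd N : bounded_op (\sum_(n < N) P n - S).
  by apply: bounded_op_add; [exact: bounded_op_bigsum|exact: bounded_op_opp].
have cv : \sum_(0 <= n < N) r (P n x) x @[N --> \oo] --> r (S x) x.
  apply/cvgrPdist_le => e e0; have rx1 : 0 < r x x + 1 by rewrite ltr_wpDl// rdot_ge0.
  have /cvgrPdist_le/(_ (e / (r x x + 1))) := PS; rewrite divr_gt0// => /(_ isT).
  apply: filterS => N; rewrite sub0r normrN ger0_norm ?opnorm_ge0// => hN.
  rewrite -rdot_suml -rdotBl -normrN -rdotNl opprB -opsumE.
  apply: le_trans (rdot_op_bound hdot x x (bd N)) _.
  rewrite -expr2 -(rdotE hdot); apply: le_trans (ler_wpM2r (rdot_ge0 _ _) hN) _.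
  by rewrite mulrAC ler_pdivrMr// ler_pM2l// lerDl.
have up M1 M2 : \sum_(M1 <= n < M2) r (P n x) x <= r (S x) x - \sum_(0 <= n < M1) r (P n x) x.
  have cv' : \sum_(0 <= n < N) r (P n x) x - \sum_(0 <= n < M1) r (P n x) x @[N --> \oo] -->
      r (S x) x - \sum_(0 <= n < M1) r (P n x) x by apply: cvgB => //; exact: cvg_cst.
  apply: (cvgr_to_ge cv'); exists (maxn M1 M2) => // N /=; rewrite geq_max => /andP[M1N M2N].
  rewrite (@big_cat_nat _ _ _ M1 0%N N)//= addrAC subrr add0r.
  have [M21|/ltnW M12] := leqP M2 M1; first by rewrite big_geq// sumr_ge0.
  by rewrite [leRHS](@big_cat_nat _ _ _ M2)//= lerDl sumr_ge0.
have rx0 := rdot_ge0 dot x.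
rewrite minr_pMl// le_min; apply/andP; split.
  apply: le_trans (rdot_op_le hdot x bS).
  have := up N1 N2; have : 0 <= \sum_(0 <= n < N1) r (P n x) x by rewrite sumr_ge0.
  lra.
apply: le_trans (up N1 N2) _.
rewrite -rdot_suml -rdotBl -opnormN -opsumE.
have -> : S x - (\sum_(n < N1) P n) x = (- (\sum_(n < N1) P n - S)) x.
  by rewrite opprB.
by apply: rdot_op_le => //; exact: bounded_op_opp.
Qed.

Lemma opseries_tail_small (P : nat -> H -> H) (S : H -> H) : (forall n, bounded_op (P n)) ->
  (forall n x, 0 <= r (P n x) x) -> bounded_op S -> opseries_cvg P S ->
  forall e, 0 < e -> exists N, forall N1 N2, (N <= N1)%N -> forall x,
    \sum_(N1 <= n < N2) r (P n x) x <= e * r x x.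
Proof.
move=> bP P0 bS PS e e0.
have /cvgrPdist_le/(_ e e0)[N _ hN] := PS.
exists N => N1 N2 NN1 x; apply: le_trans (opseries_form_le bP P0 bS PS N1 N2 x) _.
apply: ler_wpM2r; first exact: rdot_ge0.
rewrite ge_min; apply/orP; right.
by have := hN N1 NN1; rewrite sub0r normrN => /(le_trans (ler_norm _)).
Qed.

End OperatorSeries.

(** * Adjoints and strong limits in a commutative von Neumann algebra *)

Section Algebra.
Variables (R : realType) (H : completeNormedModType R[i]).
Variable dot : {dot H for (@Num.conj R[i])}.
Hypothesis hdot : hilbert_dot dot.
Variable A : set (H -> H).
Hypothesis hA : von_neumann_algebra dot A.
Hypothesis hcomm : commutative_alg A.
Local Notation r := (rdot dot).
Local Notation "T ^*" := (adj dot T).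

Lemma vna_comm S T x : A S -> A T -> S (T x) = T (S x).
Proof. by move=> AS AT; have /(congr1 (fun f => f x)) := hcomm AS AT. Qed.

Lemma vna_0 : A 0.
Proof.
by have := vna_scale hA 0 (vna_id hA); rewrite scale0r.
Qed.

Lemma vna_sum (u : nat -> H -> H) N : (forall n, A (u n)) -> A (\sum_(n < N) u n).
Proof.
by move=> Au; elim/big_ind: _ => // [|S T]; [exact: vna_0|exact: vna_add hA _ _].
Qed.

(** Adjoints are unique, so the one chosen by [adj] is the one that [vna_adj] finds in [A]. *)
Lemma adjP T : A T -> A (T^*) /\ is_adjoint dot T (T^*).
Proof.
move=> AT; have [S AS ST] := vna_adj hA AT.
have [bT' T'] : [set S | bounded_op S /\ is_adjoint dot T S] (T^*).
  by apply: xgetPex; exists S; split=> //; exact: vna_bounded hA _ AS.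
have <- // : S = T^*.
apply/funext => x; apply: (@rdot_inj _ _ dot) => y.
by rewrite rdotC -(adjoint_rdot _ _ ST) (adjoint_rdot _ _ T') rdotC.
Qed.

Lemma vna_adjT T : A T -> A (T^*).
Proof. by case/adjP. Qed.

Lemma rdot_adj T x y : A T -> r (T x) y = r x (T^* y).
Proof. by case/adjP => _ /adjoint_rdot. Qed.

Lemma rdot_adjl T x y : A T -> r (T^* x) y = r x (T y).
Proof. by move=> AT; rewrite rdotC -rdot_adj// rdotC. Qed.

Lemma adj_sq T x : A T -> r (T^* x) (T^* x) = r (T x) (T x).
Proof.
move=> AT; rewrite rdot_adjl// vna_comm//; last exact: vna_adjT.
by rewrite -rdot_adj.
Qed.

(** A pointwise limit of a sequence lies in the closure for pointwise convergence; the bound by [C]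
    makes it continuous, as [vna_closed] demands. *)
Lemma vna_lim (u : nat -> H -> H) (T : H -> H) (C : R) : (forall n, A (u n)) ->
  (forall x, u n x @[n --> \oo] --> T x) -> (forall x, nrm (T x) <= C * nrm x) -> A T.
Proof.
move=> Au uT TC.
have bT : bounded_op T.
  apply: (bounded_op_of_bound _ TC) => c x y.
  have h : u n (c *: x + y) @[n --> \oo] --> c *: T x + T y.
    rewrite (_ : (fun n => _) = (fun n => c *: u n x + u n y)); last first.
      by apply/funext => n; rewrite (vna_bounded hA (Au n)).1.
    by apply: cvgD => //; apply: cvgZr.
  by apply: cvg_unique h => //; exact: uT.
apply: (vna_closed hA bT) => B nB.
have : {ptws, u n @[n --> \oo] --> T}.
  by apply/pointwise_cvgP => x; exact: uT.
move=> /(_ B nB)[N _ hN]; exists (u N); split => //.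
exact: hN N (leqnn N).
Qed.

End Algebra.

(** * Square-summable sequences of operators *)

Section SquareSummable.
Variables (R : realType) (H : completeNormedModType R[i]).
Variable dot : {dot H for (@Num.conj R[i])}.
Hypothesis hdot : hilbert_dot dot.
Variable A : set (H -> H).
Hypothesis hA : von_neumann_algebra dot A.
Hypothesis hcomm : commutative_alg A.
Local Notation r := (rdot dot).
Local Notation "T ^*" := (adj dot T).
Local Notation bdA := (vna_bounded hA).

Definition op_sqsum_le (a : nat -> H -> H) (K : R) :=
  forall x, sqsum_le dot (fun n => a n x) (K * r x x).

Lemma rdot_mul_adj T x : A T -> r (T (T^* x)) x = r (T x) (T x).
Proof. by move=> AT; rewrite (rdot_adj hA)// (adj_sq hA). Qed.

Lemma vna_mul_adj T : A T -> A (T \o T^*).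
Proof. by move=> AT; apply: (vna_comp hA) => //; exact: (vna_adjT hA). Qed.

Lemma vna_partial_sum (a : nat -> H -> H) N : (forall n, A (a n)) ->
  A (\sum_(n < N) (a n \o adj dot (a n))).
Proof.
move=> Aa; apply: (vna_sum hA (u := fun n => a n \o adj dot (a n))) => n.
exact: vna_mul_adj.
Qed.

Lemma partial_sumE (a : nat -> H -> H) N x :
  (\sum_(n < N) (a n \o adj dot (a n))) x = \sum_(0 <= n < N) a n (adj dot (a n) x).
Proof. exact: (opsumE (fun n => a n \o adj dot (a n))). Qed.

Lemma partial_sum_form (a : nat -> H -> H) N x : (forall n, A (a n)) ->
  r ((\sum_(n < N) (a n \o adj dot (a n))) x) x = \sum_(0 <= n < N) r (a n x) (a n x).
Proof.
move=> Aa; rewrite partial_sumE rdot_suml; apply: eq_bigr => n _; exact: rdot_mul_adj.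
Qed.

Lemma partial_sum_sym (a : nat -> H -> H) N x y : (forall n, A (a n)) ->
  r ((\sum_(n < N) (a n \o adj dot (a n))) x) y =
  r x ((\sum_(n < N) (a n \o adj dot (a n))) y).
Proof.
move=> Aa; rewrite !partial_sumE rdot_suml rdot_sumr; apply: eq_bigr => n _.
by rewrite (rdot_adj hA)// (rdot_adjl hA).
Qed.

(** The partial sums of a_n adj(a_n) are symmetric with form sum |a_n x|^2, so bounding their norms
    amounts to bounding their forms. From here on only vectors are estimated. *)
Lemma l2_strongP a : l2_strong dot A a <->
  (forall n, A (a n)) /\ exists2 K, 0 < K & op_sqsum_le a K.
Proof.
split=> [[Aa [K hK]]|[Aa [K K0 hK]]]; split=> //.
  exists (`|K| + 1); first by rewrite ltr_wpDl.
  move=> x N; rewrite -partial_sum_form//.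
  have bS : bounded_op (\sum_(n < N) (a n \o adj dot (a n))).
    by apply: bdA; exact: vna_partial_sum.
  apply: le_trans (rdot_op_le hdot x bS) _; rewrite ler_wpM2r ?rdot_ge0//.
  apply: le_trans (hK N) _; have := ler_norm K; lra.
exists K => N; apply: (opnorm_form_le hdot (ltW K0)).
- by apply: bounded_op_rlinear; apply: bdA; exact: vna_partial_sum.
- by move=> x y; exact: partial_sum_sym.
- by move=> x; rewrite partial_sum_form// hK sumr_ge0// => n _; exact: rdot_ge0.
Qed.

(** An instance of [sum_sq_le]: a_n is moved to the test vector, where normality replaces adj(a_n) w
    by a_n w in norm. *)
Lemma sum_adj_sq_le a K (u : nat -> H) N1 N2 : (forall n, A (a n)) -> 0 < K -> op_sqsum_le a K ->
  r (\sum_(N1 <= n < N2) a n (u n)) (\sum_(N1 <= n < N2) a n (u n)) <=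
    K * \sum_(N1 <= n < N2) r (u n) (u n).
Proof.
move=> Aa K0 aK.
apply: (@sum_sq_le _ _ dot _ a u (fun n => r (u n) (u n)) (fun n w => r (a n w) (a n w)) K K0).
  by move=> n w t t0; rewrite (rdot_adj hA)// -(adj_sq hA)//; exact: rdot_young.
by move=> w; apply: sum_sub_le => [n|]; [exact: rdot_ge0|exact: aK].
Qed.

Lemma op_sqsum_adj a K x : (forall n, A (a n)) -> op_sqsum_le a K ->
  sqsum_le dot (fun n => adj dot (a n) x) (K * r x x).
Proof.
by move=> Aa aK N; under eq_bigr do rewrite (adj_sq hA)//; exact: aK.
Qed.

(** Makes the [lim] in [l2_dot] a genuine limit: by [sum_adj_sq_le] its blocks are controlled by the
    tails of sum |adj(b_n) x|^2. *)
Lemma l2_dot_cvg a b x : l2_strong dot A a -> l2_strong dot A b ->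
  \sum_(0 <= n < N) a n (adj dot (b n) x) @[N --> \oo] --> l2_dot dot a b x.
Proof.
move=> /l2_strongP[Aa [K K0 aK]] /l2_strongP[Ab [K' K'0 bK]].
suff : cvg (\sum_(0 <= n < N) a n (adj dot (b n) x) @[N --> \oo]).
  rewrite /l2_dot (_ : (fun N => \sum_(n < N) _) =
    (fun N => \sum_(0 <= n < N) a n (adj dot (b n) x))) //.
  by apply/funext => N; rewrite big_mkord.
apply: (@cvg_of_rdot_cauchy _ _ _ hdot) => e e0.
have [N hN] := sum_tail_small (fun n => rdot_ge0 dot (adj dot (b n) x))
  (op_sqsum_adj x Ab bK) (divr_gt0 e0 K0).
exists N => n1 n2 /andP[Nn1 n12].
rewrite (@big_cat_nat _ _ _ n1)//= addrAC subrr add0r.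
apply: le_trans (sum_adj_sq_le _ n1 n2 Aa K0 aK) _.
by rewrite mulrC -ler_pdivlMr// hN.
Qed.

Lemma l2_dot_form_cvg a x : l2_strong dot A a ->
  \sum_(0 <= n < N) r (a n x) (a n x) @[N --> \oo] --> r (l2_dot dot a a x) x.
Proof.
move=> sa; have [Aa _] := (l2_strongP a).1 sa.
have h := cvg_rdotl hdot (y := x) (l2_dot_cvg (x := x) sa sa).
rewrite (_ : (fun N => _) = (fun N => r (\sum_(0 <= n < N) a n (adj dot (a n) x)) x)) //.
by apply/funext => N; rewrite rdot_suml; apply: eq_bigr => n _; rewrite rdot_mul_adj.
Qed.

Lemma l2_dot_sym a x y : l2_strong dot A a ->
  r (l2_dot dot a a x) y = r x (l2_dot dot a a y).
Proof.
move=> sa; have [Aa _] := (l2_strongP a).1 sa.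
have h := cvg_rdotl hdot (y := y) (l2_dot_cvg (x := x) sa sa).
have h' := cvg_rdotr hdot (y := x) (l2_dot_cvg (x := y) sa sa).
apply: cvg_unique h _ => //; apply: cvg_trans h'; apply: near_eq_cvg; apply: nearW => N.
rewrite rdot_suml rdot_sumr; apply: eq_bigr => n _.
by rewrite (rdot_adj hA)// (rdot_adjl hA).
Qed.

Lemma l2_dot_vna a : l2_strong dot A a -> A (l2_dot dot a a).
Proof.
move=> sa; have [Aa [K K0 aK]] := (l2_strongP a).1 sa.
apply: (vna_lim hA (C := K) (u := fun N => \sum_(n < N) (a n \o adj dot (a n)))).
- by move=> N; exact: vna_partial_sum.
- move=> x; rewrite (_ : (fun N => _) = (fun N => \sum_(0 <= n < N) a n (adj dot (a n) x))).
    exact: l2_dot_cvg.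
  by apply/funext => N; rewrite partial_sumE.
move=> x; apply: (nrm_le_sq hdot); first by rewrite mulr_ge0 ?nrm_ge0// ltW.
apply: (cvgr_to_le (cvg_rdot_sq hdot (l2_dot_cvg (x := x) sa sa))); apply: nearW => N.
apply: le_trans (sum_adj_sq_le _ 0 N Aa K0 aK) _.
rewrite exprMn -(rdotE hdot) expr2 -mulrA ler_pM2l//.
exact: (op_sqsum_adj x Aa aK).
Qed.

(** Together with [l2_dot_opnorm_le] this identifies the norm of <a, a> as the least nonnegative
    constant in [op_sqsum_le]. *)
Lemma l2_dot_opnorm a : l2_strong dot A a -> op_sqsum_le a (opnorm (l2_dot dot a a)).
Proof.
move=> sa x N.
apply: le_trans (rdot_op_le hdot x (bdA (l2_dot_vna sa))).
apply: (cvgr_to_ge (l2_dot_form_cvg (x := x) sa)); exists N => // M /= NM.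
by rewrite [leRHS](@big_cat_nat _ _ _ N)//= lerDl sumr_ge0// => n _; exact: rdot_ge0.
Qed.

Lemma l2_dot_opnorm_le a K : 0 <= K -> l2_strong dot A a -> op_sqsum_le a K ->
  opnorm (l2_dot dot a a) <= K.
Proof.
move=> K0 sa aK; apply: (opnorm_form_le hdot K0).
- by apply: bounded_op_rlinear; apply: bdA; exact: l2_dot_vna.
- by move=> x y; exact: l2_dot_sym.
move=> x; apply/andP; split.
  apply: (cvgr_to_ge (l2_dot_form_cvg (x := x) sa)); apply: nearW => N.
  by rewrite sumr_ge0// => n _; exact: rdot_ge0.
by apply: (cvgr_to_le (l2_dot_form_cvg (x := x) sa)); apply: nearW => N; exact: aK.
Qed.

(** The norm Cauchy condition for the series of a_n adj(a_n), written with forms: [N] is uniform in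
    [x]. *)
Definition uniform_tail (a : nat -> H -> H) :=
  forall e, 0 < e -> exists N, forall N1 N2, (N <= N1)%N -> forall x,
    \sum_(N1 <= n < N2) r (a n x) (a n x) <= e * r x x.

(** For positive terms, norm convergence means uniformly small tails of the forms. Conversely the
    norm limit has to be the strong sum [l2_dot]; the remainder is symmetric with form between 0 and
    e |x|^2, so [opnorm_form_le] bounds its norm. *)
Lemma l2P a : l2 dot A a <-> l2_strong dot A a /\ uniform_tail a.
Proof.
split=> [[Aa [S AS aS]]|[sa ta]].
  have bP n : bounded_op (a n \o adj dot (a n)) by apply: bdA; exact: vna_mul_adj.
  have PE n x : r ((a n \o adj dot (a n)) x) x = r (a n x) (a n x) by exact: rdot_mul_adj.
  have P0 n x : 0 <= r ((a n \o adj dot (a n)) x) x by rewrite PE rdot_ge0.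
  split; last first.
    move=> e e0; have [N hN] := opseries_tail_small hdot bP P0 (bdA AS) aS e0.
    exists N => N1 N2 NN x; have := hN N1 N2 NN x.
    by under eq_bigr do rewrite PE.
  apply/l2_strongP; split=> //; exists (opnorm S + 1).
    by rewrite ltr_wpDl// opnorm_ge0//; exact: bdA.
  move=> x N; have := opseries_form_le hdot bP P0 (bdA AS) aS 0 N x.
  under eq_bigr do rewrite PE.
  move=> /le_trans; apply; apply: ler_wpM2r; first exact: rdot_ge0.
  by rewrite ge_min lerDl ler01.
have [Aa _] := (l2_strongP a).1 sa; split => //.
exists (l2_dot dot a a); first exact: l2_dot_vna.
apply/cvgrPdist_le => e e0; have [N hN] := ta e e0.
exists N => // n /= Nn; rewrite sub0r normrN -opnormN.
have bS : bounded_op (- (\sum_(k < n) (a k \o adj dot (a k)) - l2_dot dot a a)).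
  apply/bounded_op_opp/bounded_op_add; last exact/bounded_op_opp/bdA/l2_dot_vna.
  by apply: bdA; exact: vna_partial_sum.
rewrite ger0_norm; last exact: opnorm_ge0.
apply: (opnorm_form_le hdot (ltW e0)); first exact: bounded_op_rlinear.
  move=> x y; rewrite opprB.
  change (r (l2_dot dot a a x - (\sum_(k < n) (a k \o adj dot (a k))) x) y =
    r x (l2_dot dot a a y - (\sum_(k < n) (a k \o adj dot (a k))) y)).
  rewrite rdotBl rdotBr l2_dot_sym//; congr (_ - _).
  exact: partial_sum_sym.
move=> x; rewrite opprB.
change (0 <= r (l2_dot dot a a x - (\sum_(k < n) (a k \o adj dot (a k))) x) x <= e * r x x).
rewrite rdotBl partial_sum_form//.
have h : \sum_(0 <= k < M) r (a k x) (a k x) - \sum_(0 <= k < n) r (a k x) (a k x) @[M --> \oo] -->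
    r (l2_dot dot a a x) x - \sum_(0 <= k < n) r (a k x) (a k x).
  by apply: cvgB; [exact: l2_dot_form_cvg|exact: cvg_cst].
apply/andP; split.
  apply: (cvgr_to_ge h); exists n => // M /= nM.
  rewrite (@big_cat_nat _ _ _ n 0%N M)//= addrAC subrr add0r sumr_ge0// => k _.
  exact: rdot_ge0.
apply: (cvgr_to_le h); exists n => // M /= nM.
rewrite (@big_cat_nat _ _ _ n 0%N M)//= addrAC subrr add0r.
exact: hN.
Qed.

End SquareSummable.

(** * Matrices acting on sequences of operators *)

Definition mxop (R : realType) (H : completeNormedModType R[i])
    (m : nat -> nat -> H -> H) (a : nat -> H -> H) (j : nat) (x : H) : H :=
  mxapp m (fun k => a k x) j.

Section SchurOperator.
Variables (R : realType) (H : completeNormedModType R[i]).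
Variable dot : {dot H for (@Num.conj R[i])}.
Hypothesis hdot : hilbert_dot dot.
Variable A : set (H -> H).
Hypothesis hA : von_neumann_algebra dot A.
Hypothesis hcomm : commutative_alg A.
Local Notation r := (rdot dot).
Local Notation "T ^*" := (adj dot T).
Local Notation bdA := (vna_bounded hA).
Variables (m : nat -> nat -> H -> H) (q : nat -> nat -> H -> R) (Bc Br : R).
Hypothesis Am : forall j k, A (m j k).
Hypothesis S : schur_matrix dot m q Bc Br.

Let Bc0 : 0 < Bc := sm_Bc S.
Let Br0 : 0 < Br := sm_Br S.

Lemma mxop_cvg a j x : l2_strong dot A a ->
  \sum_(0 <= k < N) m j k (a k x) @[N --> \oo] --> mxop m a j x.
Proof.
by move=> /(l2_strongP hdot hA hcomm)[_ [K K0 aK]]; exact: (mxapp_cvg hdot S (aK x)).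
Qed.

Lemma mxop_op_sqsum a K : op_sqsum_le dot a K -> op_sqsum_le dot (mxop m a) (Br * (Bc * K)).
Proof. by move=> aK x; rewrite -!mulrA; exact: (mxapp_sqsum hdot S (aK x)). Qed.

Lemma mxop_vna a j : l2_strong dot A a -> A (mxop m a j).
Proof.
move=> sa; have [Aa [K K0 aK]] := (l2_strongP hdot hA hcomm a).1 sa.
have C0 : 0 <= Br * (Bc * K) by rewrite !mulr_ge0// ltW.
apply: (vna_lim hA (C := Num.sqrt (Br * (Bc * K))) (u := fun N => \sum_(k < N) (m j k \o a k))).
- move=> N; apply: (vna_sum hA (u := fun k => m j k \o a k)) => k; exact: (vna_comp hA).
- move=> x; rewrite (_ : (fun N => _) = (fun N => \sum_(0 <= k < N) m j k (a k x))).
    exact: mxop_cvg.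
  by apply/funext => N; rewrite (opsumE (fun k => m j k \o a k)).
move=> x; apply: (nrm_le_sq hdot); first by rewrite mulr_ge0 ?nrm_ge0// sqrtr_ge0.
rewrite exprMn sqr_sqrtr// -(rdotE hdot).
(* A single entry is bounded by the whole sum of squares, read off at length j + 1. *)
have : \sum_(0 <= i < j.+1) r (mxop m a i x) (mxop m a i x) <= Br * (Bc * K) * r x x.
  exact: (mxop_op_sqsum aK).
apply: le_trans; rewrite big_nat_recr//= lerDr sumr_ge0// => i _; exact: rdot_ge0.
Qed.

Lemma mxop_l2_strong a : l2_strong dot A a -> l2_strong dot A (mxop m a).
Proof.
move=> sa; have [Aa [K K0 aK]] := (l2_strongP hdot hA hcomm a).1 sa.
apply/(l2_strongP hdot hA hcomm); split; first by move=> j; exact: mxop_vna.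
by exists (Br * (Bc * K)); [rewrite !mulr_gt0|exact: mxop_op_sqsum].
Qed.

Lemma mxop_l2 a : l2 dot A a -> l2 dot A (mxop m a).
Proof.
move=> /(l2P hdot hA hcomm)[sa ta]; apply/(l2P hdot hA hcomm); split; first exact: mxop_l2_strong.
have [Aa [K K0 aK]] := (l2_strongP hdot hA hcomm a).1 sa.
move=> e e0.
(* Both terms in the bound of [mxapp_tail] are to contribute (e / 2) |x|^2. *)
have eD : 0 < e / (2 * (Br * Bc)) by rewrite divr_gt0// !mulr_gt0.
have eK : 0 < e / (2 * (Br * K)) by rewrite divr_gt0// !mulr_gt0.
have [N0 hN0] := ta _ eD.
have [J hJ] := mxapp_tail hdot S N0 eK.
exists J => J1 J2 JJ x.
apply: le_trans (hJ J1 J2 JJ _ _ _ (aK x) (fun N => hN0 N0 N (leqnn _) x)) _.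
by rewrite le_eqVlt; apply/orP; left; apply/eqP; field; rewrite !gt_eqF.
Qed.

Lemma mxop_opseries a j : l2_strong dot A a ->
  opseries_cvg (fun k => m j k \o a k) (mxop m a j).
Proof.
move=> sa; have [Aa [K K0 aK]] := (l2_strongP hdot hA hcomm a).1 sa.
apply/cvgrPdist_le => e e0.
(* [mxapp_trunc] bounds a squared norm, and the vectors a_k x have square sum at most K |x|^2. *)
have eK : 0 < e ^+ 2 / K by rewrite divr_gt0// exprn_gt0.
have [N hN] := mxapp_trunc hdot S j eK.
exists N => // n /= Nn; rewrite sub0r normrN ger0_norm; last first.
  apply: opnorm_ge0; apply: bounded_op_add; last exact/bounded_op_opp/bdA/mxop_vna.
  by apply: bdA; apply: (vna_sum hA (u := fun k => m j k \o a k)) => k; exact: (vna_comp hA).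
apply: opnorm_le; first exact: ltW.
move=> x; apply: (nrm_le_sq hdot); first by rewrite mulr_ge0 ?nrm_ge0// ltW.
rewrite exprMn -(rdotE hdot).
have := hN n Nn _ _ (aK x).
rewrite mulrA divfK ?gt_eqF//; apply: le_trans.
rewrite le_eqVlt; apply/orP; left; apply/eqP.
change (r ((\sum_(k < n) (m j k \o a k)) x - mxop m a j x)
    ((\sum_(k < n) (m j k \o a k)) x - mxop m a j x) =
  r (\sum_(0 <= k < n) m j k (a k x) - mxop m a j x)
    (\sum_(0 <= k < n) m j k (a k x) - mxop m a j x)).
by rewrite (opsumE (fun k => m j k \o a k)).
Qed.

(** Commutativity carries [c] past m_jk, and continuity of [c] carries it through the limit. *)
Lemma mxop_linear c a b : A c -> l2_strong dot A a -> l2_strong dot A b ->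
  mxop m (fun n => c \o a n + b n) = (fun n => c \o mxop m a n + mxop m b n).
Proof.
move=> Ac sa sb; apply/funext => j; apply/funext => x.
have h : \sum_(0 <= k < N) m j k (c (a k x) + b k x) @[N --> \oo] -->
    c (mxop m a j x) + mxop m b j x.
  rewrite (_ : (fun N => _) = (fun N =>
      c (\sum_(0 <= k < N) m j k (a k x)) + \sum_(0 <= k < N) m j k (b k x))).
    apply: cvgD; last exact: mxop_cvg.
    apply: continuous_cvg; last exact: mxop_cvg.
    exact: (bdA Ac).2.
  apply/funext => N; rewrite (bounded_op_sum _ _ _ (bdA Ac)) -big_split /=.
  apply: eq_bigr => k _; rewrite (bounded_opD _ _ (bdA (Am j k))).
  by rewrite (vna_comm hcomm (a k x) (Am j k) Ac).
exact: (cvg_lim _ h).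
Qed.

Lemma mxop_norm a : l2_strong dot A a -> l2_norm dot a <= 1 ->
  l2_norm dot (mxop m a) <= Num.sqrt (Br * Bc).
Proof.
move=> sa; rewrite /l2_norm => a1; apply: ler_wsqrtr.
have ao := opnorm_ge0 (bdA (l2_dot_vna hdot hA hcomm sa)).
have {}a1 : opnorm (l2_dot dot a a) <= 1.
  by rewrite -(sqr_sqrtr ao) expr_le1// sqrtr_ge0.
apply: (l2_dot_opnorm_le hdot hA hcomm); first by rewrite mulr_ge0// ltW.
  exact: mxop_l2_strong.
(* The unit ball is the case K = 1 of the Schur bound. *)
rewrite -(mulr1 Bc); apply: mxop_op_sqsum => x N.
apply: le_trans (l2_dot_opnorm hdot hA hcomm sa x N) _.
by rewrite ler_wpM2r ?rdot_ge0.
Qed.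

End SchurOperator.

(** * The adjoint matrix *)

Section Adjoint.
Variables (R : realType) (H : completeNormedModType R[i]).
Variable dot : {dot H for (@Num.conj R[i])}.
Hypothesis hdot : hilbert_dot dot.
Variable A : set (H -> H).
Hypothesis hA : von_neumann_algebra dot A.
Hypothesis hcomm : commutative_alg A.
Local Notation r := (rdot dot).
Local Notation "T ^*" := (adj dot T).
Local Notation bdA := (vna_bounded hA).
Variables (m : nat -> nat -> H -> H) (q : nat -> nat -> H -> R) (Bc Br : R).
Hypothesis Am : forall j k, A (m j k).
Hypothesis S : schur_matrix dot m q Bc Br.
Let m' j k := (m k j)^*.

Lemma mxadj_vna j k : A (m' j k).
Proof. exact: (vna_adjT hA). Qed.

Lemma mxadj_schur : schur_matrix dot m' (fun j k => q k j) Br Bc.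
Proof.
apply: (schur_matrix_tr S) => [j k v w|j k v w].
  exact: bounded_opD (bdA (mxadj_vna j k)).
exact: (rdot_adj hA).
Qed.

(** Tested against x and y, both sides are iterated sums of c_jk = <m_jk u_j, v_k> with u_j =
    adj(b_j) x and v_k = adj(a_k) y, once with the sum over k inside and once with the sum over j
    inside. [double_sum_swap] exchanges them. *)
Lemma mxop_adjoint a b : l2_strong dot A a -> l2_strong dot A b ->
  l2_dot dot (mxop m a) b = l2_dot dot a (mxop m' b).
Proof.
move=> sa sb; have [Aa [Ka Ka0 aK]] := (l2_strongP hdot hA hcomm a).1 sa.
have [Ab [Kb Kb0 bK]] := (l2_strongP hdot hA hcomm b).1 sb.
have S' := mxadj_schur.
have sLa := mxop_l2_strong hdot hA hcomm Am S sa.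
have sLb := mxop_l2_strong hdot hA hcomm mxadj_vna S' sb.
apply/funext => x; apply: (@rdot_inj _ _ dot) => y.
have lhs := cvg_rdotl hdot (y := y) (l2_dot_cvg hdot hA hcomm (x := x) sLa sb).
have rhs := cvg_rdotl hdot (y := y) (l2_dot_cvg hdot hA hcomm (x := x) sa sLb).
pose u j := adj dot (b j) x; pose v k := adj dot (a k) y.
pose c j k := r (m j k (u j)) (v k).
pose f j := r (mxop m a j (u j)) y.
pose g k := r (a k (adj dot (mxop m' b k) x)) y.
have cf j : \sum_(0 <= k < M) c j k @[M --> \oo] --> f j.
  have := cvg_rdotl hdot (y := y) (mxop_cvg hdot hA hcomm S (j := j) (x := u j) sa).
  apply: cvg_trans; apply: near_eq_cvg; apply: nearW => M; rewrite rdot_suml.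
  by apply: eq_bigr => k _; rewrite /c /v -(rdot_adj hA)// (vna_comm hcomm).
have cg k : \sum_(0 <= j < M) c j k @[M --> \oo] --> g k.
  have -> : g k = r x (mxop m' b k (v k)).
    by rewrite /g (rdot_adj hA)// (rdot_adjl hA)//; exact: (mxop_vna hdot hA hcomm mxadj_vna S').
  have := cvg_rdotr hdot (y := x) (mxop_cvg hdot hA hcomm S' (j := k) (x := v k) sb).
  apply: cvg_trans; apply: near_eq_cvg; apply: nearW => M; rewrite rdot_sumr.
  apply: eq_bigr => j _; rewrite /c /u /m' (rdot_adj hA)// (rdot_adjl hA)//.
  by rewrite (vna_comm hcomm) //; exact: (vna_adjT hA).
have Bc0 := sm_Bc S; have Br0 := sm_Br S.
have h := double_sum_swap cf cg
  (fun j => mulr_ge0 (ltW Br0) (rdot_ge0 dot (u j)))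
  (fun k => mulr_ge0 (ltW Bc0) (rdot_ge0 dot (v k))) _ _
  (fun J1 J2 K1 K2 t => @schur_bilinear _ _ dot m q Bc Br S u v J1 J2 K1 K2 t).
have {h} h := h (Br * (Kb * r x x)) (Bc * (Ka * r y y)).
apply/eqP; rewrite -subr_eq0; apply/eqP.
(* The partial differences tend to the difference of the two sides and, by [h], to 0. *)
have d : r (\sum_(0 <= n < N) mxop m a n (adj dot (b n) x)) y -
         r (\sum_(0 <= n < N) a n (adj dot (mxop m' b n) x)) y @[N --> \oo] -->
         r (l2_dot dot (mxop m a) b x) y - r (l2_dot dot a (mxop m' b) x) y.
  exact: cvgB.
apply: cvg_unique d _ => //.
rewrite (_ : (fun N => _) = (fun N => \sum_(0 <= j < N) f j - \sum_(0 <= k < N) g k)); last first.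
  by apply/funext => N; rewrite !rdot_suml.
apply: h => N; rewrite -mulr_sumr ler_pM2l//.
  exact: (op_sqsum_adj hA hcomm x Ab bK).
exact: (op_sqsum_adj hA hcomm y Aa aK).
Qed.

End Adjoint.

(** * The forms of the p_jk satisfy the Schur conditions; the theorem *)

Lemma sqrt_op_schur (R : realType) (H : completeNormedModType R[i])
    (dot : {dot H for (@Num.conj R[i])}) (hdot : hilbert_dot dot)
    (A : set (H -> H)) (hA : von_neumann_algebra dot A) (hcomm : commutative_alg A)
    (m : nat -> nat -> H -> H) (hm : forall j k, A (m j k))
    (p : nat -> nat -> H -> H)
    (hp : forall j k, is_sqrt_op dot (adj dot (m j k) \o m j k) (p j k))
    (Bc Br : R) (hBc : 0 < Bc) (hBr : 0 < Br)
    (hcol : forall k, exists S : H -> H,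
      [/\ A S, opseries_cvg (fun j => p j k) S & opnorm S <= Bc])
    (hrow : forall j, exists S : H -> H,
      [/\ A S, opseries_cvg (fun k => p j k) S & opnorm S <= Br]) :
  schur_matrix dot m (fun j k w => rdot dot (p j k w) w) Bc Br.
Proof.
have bdA := vna_bounded hA.
have pp j k : positive_op dot (p j k) by case: (hp j k).
have bp j k : bounded_op (p j k) by case: (pp j k).
have mp j k x : rdot dot (m j k x) (m j k x) = rdot dot (p j k x) (p j k x).
  have /(congr1 (fun f => f x)) /= e := (hp j k).2.
  by rewrite (rdot_adj hA)// -e (positive_op_sym (pp j k)).
(* Serves rows and columns alike. *)
have form_bound (P : nat -> H -> H) B : (forall n, positive_op dot (P n)) ->
    (exists S : H -> H, [/\ A S, opseries_cvg P S & opnorm S <= B]) ->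
    (forall N1 N2 w, \sum_(N1 <= n < N2) rdot dot (P n w) w <= B * rdot dot w w) /\
    forall e, 0 < e -> exists N, forall N1 N2, (N <= N1)%N -> forall w,
      \sum_(N1 <= n < N2) rdot dot (P n w) w <= e * rdot dot w w.
  move=> PP [S [AS PS SB]].
  have bP n : bounded_op (P n) by case: (PP n).
  have P0 n x : 0 <= rdot dot (P n x) x by exact: positive_op_ge0.
  split; last exact: (opseries_tail_small hdot bP P0 (bdA _ AS) PS).
  move=> N1 N2 w; apply: le_trans (opseries_form_le hdot bP P0 (bdA _ AS) PS N1 N2 w) _.
  by apply: ler_wpM2r; [exact: rdot_ge0|rewrite ge_min SB].
split=> //.
- by move=> j k v w; exact: (bounded_opD _ _ (bdA _ (hm j k))).
- move=> j k v w t t0.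
  have le1 v' w' : 2 * rdot dot (m j k v') w' <= rdot dot (p j k v') v' + rdot dot (p j k w') w'.
    apply: (rdot_le_abs hdot v' w' (bdA _ (hm j k)) (bdA _ (vna_adjT hA (hm j k)))
      (adjP hA (hm j k)).2 (pp j k)) => x.
      exact: mp.
    by rewrite (adj_sq hA)// mp.
  (* The weight t comes from scaling v by the square root of t and w' by its inverse, which leaves
     <m v, w'> unchanged. *)
  have le2 w' : 2 * rdot dot (m j k v) w' <=
      t * rdot dot (p j k v) v + t^-1 * rdot dot (p j k w') w'.
    have s0 : 0 < Num.sqrt t by rewrite sqrtr_gt0.
    have := le1 ((Num.sqrt t)%:C%C *: v) ((Num.sqrt t)^-1%:C%C *: w').
    rewrite !(rlinearZ _ _ (bounded_op_rlinear (bp j k))).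
    rewrite (rlinearZ _ _ (bounded_op_rlinear (bdA _ (hm j k)))).
    by rewrite !rdotZl !rdotZr !mulrA -(mulrA 2) divff ?gt_eqF// mulr1
       -invfM -expr2 sqr_sqrtr ?(ltW t0)//.
  (* For the absolute value, a negative left side is treated with -w, which has the same form as
     w. *)
  have [_|_] := ger0P (rdot dot (m j k v) w); first exact: le2.
  have := le2 (- w); rewrite (bounded_opN _ (bp j k)) rdotNl !(rdotC dot _ (- w)) !rdotNl opprK.
  by rewrite (rdotC dot w (m j k v)) (rdotC dot w (p j k w)).
- by move=> j k v; exact: positive_op_ge0.
- by move=> j; have [] := form_bound _ _ (pp j) (hrow j).
- by move=> k; have [] := form_bound _ _ (pp^~ k) (hcol k).
- by move=> j; have [] := form_bound _ _ (pp j) (hrow j).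
- by move=> k; have [] := form_bound _ _ (pp^~ k) (hcol k).
Qed.

Theorem proposition4p2 (R : realType) (H : completeNormedModType R[i])
    (dot : {dot H for (@Num.conj R[i])}) (hdot : hilbert_dot dot)
    (A : set (H -> H)) (hA : von_neumann_algebra dot A)
    (hcomm : commutative_alg A)
    (m : nat -> nat -> H -> H) (hm : forall j k, A (m j k))
    (p : nat -> nat -> H -> H)
    (hp : forall j k, is_sqrt_op dot (adj dot (m j k) \o m j k) (p j k))
    (Bc Br : R) (hBc : 0 < Bc) (hBr : 0 < Br)
    (hcol : forall k, exists S : H -> H,
      [/\ A S, opseries_cvg (fun j => p j k) S & opnorm S <= Bc])
    (hrow : forall j, exists S : H -> H,
      [/\ A S, opseries_cvg (fun k => p j k) S & opnorm S <= Br]) :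
  exists L : (nat -> H -> H) -> (nat -> H -> H),
    [/\ forall a, l2 dot A a -> forall j,
          opseries_cvg (fun k => m j k \o a k) (L a j),
        module_map A (l2 dot A) L,
        (module_map_norm dot (l2 dot A) L < +oo)%E &
        exists Ls : (nat -> H -> H) -> (nat -> H -> H),
          [/\ forall a, l2 dot A a -> Ls a = L a,
              module_map A (l2_strong dot A) Ls,
              adjointable dot (l2_strong dot A) Ls &
              (module_map_norm dot (l2_strong dot A) Ls
                 <= (Num.sqrt (Br * Bc))%:E)%E]].
Proof.
have S := sqrt_op_schur hdot hA hcomm hm hp hBc hBr hcol hrow.
have sub a : l2 dot A a -> l2_strong dot A a by move=> /(l2P hdot hA hcomm)[].
(* Stated for any [E] inside the strong space, to cover both modules at once. *)
have norm_le E : (forall a, E a -> l2_strong dot A a) ->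
    (module_map_norm dot E (mxop m) <= (Num.sqrt (Br * Bc))%:E)%E.
  move=> Es; apply: ge_ereal_sup => _ [a [Ea a1] <-]; rewrite lee_fin.
  exact: (mxop_norm hdot hA hcomm hm S (Es _ Ea)).
exists (mxop m); split.
- by move=> a /sub sa j; exact: (mxop_opseries hdot hA hcomm hm S).
- split=> [a|c a b Ac /sub sa /sub sb]; first exact: (mxop_l2 hdot hA hcomm hm S).
  exact: (mxop_linear hdot hA hcomm hm S).
- by apply: le_lt_trans (norm_le _ sub) _; rewrite ltry.
(* The same formula acts on the larger module, so the extension property holds by reflexivity. *)
exists (mxop m); split=> //; last exact: norm_le.
- split=> [a|c a b Ac sa sb]; first exact: (mxop_l2_strong hdot hA hcomm hm S).
  exact: (mxop_linear hdot hA hcomm hm S).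
- exists (mxop (fun j k => adj dot (m k j))) => [b|a b]; last first.
    exact: (mxop_adjoint hdot hA hcomm hm S).
  exact: (mxop_l2_strong hdot hA hcomm (mxadj_vna hA hm) (mxadj_schur hA hm S)).
Qed.
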